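(* The following hold. (a) Let $(\tilde W,\tilde S)$ be the hyperbolic cover of a tubular elliptic Weyl system. Then it is isomorphic to an extended Coxeter system of star type. (b) Let $(\mathcal W,\mathcal S)$ be an extended Coxeter system of star type, where $\mathcal W=\mathcal W(\overline W,\overline S)$. If the diagram $\overline\Gamma$ of $(\overline W,\overline S)$ is an affine diagram, then $(\mathcal W,\mathcal S)$ is isomorphic to the hyperbolic cover of a tubular elliptic Weyl system.
   Context: Isomorphism. If groups $G,G'$ are generated by $Q,Q'$, then $(G,Q)$ and $(G',Q')$ are isomorphic if there is a group isomorphism $G\to G'$ mapping $Q$ bijectively onto $Q'$. Extended Coxeter systems. A star is a tree with at most one vertex of degree larger than $2$. Let $(\overline W,\overline S)$ be a crystallographic Coxeter system of star type, i.e. its Dynkin diagram $\overline\Gamma$ (with only simple bonds) is a star; let $\overline\Phi$ be its root system in its standard linear representation, with simple roots $\alpha_i$ belonging to $s_i\in\overline S$, and $L(\overline\Phi)=\mathrm{span}_{\mathbb Z}(\overline\Phi)$ its root lattice. The extended Coxeter group is $\mathcal W=\mathcal W(\overline W,\overline S)=\overline W\ltimes L(\overline\Phi)$, elements written $(\overline w,\lambda)$, with multiplication $(w_1,\mu_1)(w_2,\mu_2)=(w_1w_2,w_2^{-1}(\mu_1)+\mu_2)$. Let $t$ be a vertex of $\overline\Gamma$ of maximal valence and $s_{t^\star}=(s_t,\alpha_t)$. With $\mathcal S=\overline S\cup\{s_{t^\star}\}$, $(\mathcal W,\mathcal S)$ is an extended Coxeter system of star type. Root systems. Let $V$ be a finite-dimensional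 real vector space with a symmetric bilinear form $(-\mid-)$ with radical $R$. For $(\alpha\mid\alpha)\ne0$ put $s_\alpha(v)=v-\frac{2(\alpha\mid v)}{(\alpha\mid\alpha)}\alpha$. A generalized root system is a non-empty set $\Phi\subseteq V$ of non-isotropic vectors with $\mathrm{span}_{\mathbb R}(\Phi)=V$, $s_\alpha(\Phi)\subseteq\Phi$ and $\frac{2(\alpha\mid\beta)}{(\beta\mid\beta)}\in\mathbb Z$ for all $\alpha,\beta\in\Phi$; $L(\Phi)=\mathrm{span}_{\mathbb Z}(\Phi)$ is a lattice in $V$ (generated by an $\mathbb R$-basis of $V$). It is reduced if $r\alpha\in\Phi$ implies $r=\pm1$, and irreducible if it is not a union of two mutually orthogonal generalized root systems. It is elliptic if it is irreducible and reduced and $(-\mid-)$ has signature $(n,0,2)$ (numbers of positive, negative, zero eigenvalues), $n+2=\dim V$. Standing assumption: $(\alpha\mid\alpha)=2$ for all $\alpha\in\Phi$. Fix a $1$-dimensional subspace $U\le R$ with $U\cap L(\Phi)\ne\{0\}$ and $a$ with $L(\Phi)\cap U=\mathbb Za$. The image $\Phi/U$ of $\Phi$ in $V/U$ is an irreducible affine root system; let $\beta_0,\dots,\beta_n$ be a root basis (simple system) of it such that $\beta_1,\dots,\beta_n$ is a root basis of a finite root system ($\beta_0$ being the affine node in the standard numbering), and let $m_1,\dots,m_n$ be the unique positive integers such that $\beta_0+\sum_{i=1}^n m_i\beta_i$ spans $L(\Phi/U)\cap R/U$; put $m_0=1$. Choose preimages $\alpha_i\in\Phi$ of $\beta_i$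 and put $b=\sum_{i=0}^n m_i\alpha_i\in R$, $V_{\mathrm{fin}}=\sum_{i=1}^n\mathbb R\alpha_i$. $\Phi$ is tubular if exactly one index $t$ satisfies $m_t=\max_i m_i$; then put $\alpha_{t^\star}=\alpha_t+a$, $M=\{0,\dots,n,t^\star\}$, $S=\{s_{\alpha_i}\mid i\in M\}$, $W=\langle s_\alpha\mid\alpha\in\Phi\rangle$; $(W,S)$ is called a tubular elliptic Weyl system. Hyperbolic cover. Let $\hat V=V_{\mathrm{fin}}\perp\langle a,a'\rangle\perp\langle b,b'\rangle\supseteq V$ with form extending that of $V$, $(a,a'),(b,b')$ hyperbolic pairs (isotropic vectors with product $1$), and $\tilde V=V\oplus\mathbb Rb'$. For $i\in M$ let $\tilde s_i$ be the reflection of $\tilde V$ with respect to $\alpha_i$; $\tilde S=\{\tilde s_i\mid i\in M\}$, $\tilde W=\langle\tilde S\rangle$. *)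

(* Defs.v *)
From HB Require Import structures.
From mathcomp Require Import all_boot all_order all_algebra.
From mathcomp Require Import mathcomp_extra boolp classical_sets functions.
From mathcomp Require Import cardinality reals.

Set Implicit Arguments.
Unset Strict Implicit.
Unset Printing Implicit Defensive.

Import Order.TTheory GRing.Theory Num.Theory.

Local Open Scope classical_set_scope.
Local Open Scope ring_scope.

Definition is_subgroup (gT : groupType) (H : set gT) : Prop :=
  H 1%g /\ forall x y, H x -> H y -> H (x / y)%g.

Definition generated (gT : groupType) (Q : set gT) : set gT :=
  smallest (@is_subgroup gT) Q.

(* The group is the subset [gs_group] of the ambient group [gs_type]. *)
Record gen_system := GenSystem {
  gs_type : groupType;
  gs_group : set gs_type;
  gs_gens : set gs_type }.

Definition isomorphic (X Y : gen_system) : Prop :=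
  exists f : gs_type X -> gs_type Y,
    [/\ set_bij (@gs_group X) (@gs_group Y) f,
        forall x y, gs_group x -> gs_group y -> f (x * y)%g = (f x * f y)%g
      & set_bij (@gs_gens X) (@gs_gens Y) f].

Section GeneralLinear.
Variables (K : fieldType) (V : vectType K).

Record GL := GLElt { gl_lfun : 'End(V); gl_ker : lker gl_lfun == 0%VS }.

HB.instance Definition _ := [isSub for gl_lfun].
HB.instance Definition _ := [Choice of GL by <:].

Implicit Types f g h : GL.

Definition gl_fun f : V -> V := fun v => gl_lfun f v.

Fact gl_one_subproof : lker (\1%VF : 'End(V)) == 0%VS.
Proof. by apply/lker0P => u v; rewrite !id_lfunE. Qed.

Fact gl_mul_subproof f g : lker (gl_lfun f \o gl_lfun g)%VF == 0%VS.
Proof.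
have /lker0P f_inj := gl_ker f; have /lker0P g_inj := gl_ker g.
by apply/lker0P => u v; rewrite !comp_lfunE => /f_inj/g_inj.
Qed.

Fact gl_inv_subproof f : lker ((gl_lfun f)^-1)%VF == 0%VS.
Proof. by apply/lker0P; apply: can_inj (lker0_lfunVK (gl_ker f)). Qed.

Definition gl_one : GL := GLElt gl_one_subproof.
Definition gl_mul f g : GL := GLElt (gl_mul_subproof f g).
Definition gl_inv f : GL := GLElt (gl_inv_subproof f).

Fact gl_mulA : associative gl_mul.
Proof. by move=> f g h; apply: val_inj; rewrite /= comp_lfunA. Qed.
Fact gl_mul1 : left_id gl_one gl_mul.
Proof. by move=> f; apply: val_inj; rewrite /= comp_lfun1l. Qed.
Fact gl_mulr1 : right_id gl_one gl_mul.
Proof. by move=> f; apply: val_inj; rewrite /= comp_lfun1r. Qed.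
Fact gl_mulV : left_inverse gl_one gl_inv gl_mul.
Proof. by move=> f; apply: val_inj; rewrite /= lker0_compVf ?(gl_ker f). Qed.
Fact gl_mulrV : right_inverse gl_one gl_inv gl_mul.
Proof. by move=> f; apply: val_inj; rewrite /= lker0_compfV ?(gl_ker f). Qed.

HB.instance Definition _ :=
  isGroup.Build GL gl_mulA gl_mul1 gl_mulr1 gl_mulV gl_mulrV.

End GeneralLinear.

Section SemiDirect.
Variables (K : fieldType) (V : vectType K) (W : groupType).
Variable rho : {multiplicative W -> GL V}.

Definition semidirect & {multiplicative W -> GL V} := (W * V)%type.
Local Notation T := (semidirect rho).

HB.instance Definition _ := Choice.on T.

Implicit Types x y : T.

Definition sd_one : T := (1%g, 0).
Definition sd_mul x y : T :=
  ((x.1 * y.1)%g, gl_fun (rho (y.1)^-1%g) x.2 + y.2).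
Definition sd_inv x : T := ((x.1)^-1%g, - gl_fun (rho x.1) x.2).

Fact sd_act1 v : gl_fun (rho 1%g) v = v.
Proof.
have r1 : rho 1%g = 1%g by apply: (mulgI (rho 1%g)); rewrite -gmulfM !mulg1.
by rewrite /gl_fun r1 id_lfunE.
Qed.

Fact sd_actM w1 w2 v :
  gl_fun (rho (w1 * w2)%g) v = gl_fun (rho w1) (gl_fun (rho w2) v).
Proof. by rewrite /gl_fun gmulfM /= comp_lfunE. Qed.

Fact sd_mulA : associative sd_mul.
Proof.
move=> x y z; rewrite /sd_mul /= mulgA invgM sd_actM.
by congr pair; rewrite /gl_fun linearD addrA.
Qed.
Fact sd_mul1 : left_id sd_one sd_mul.
Proof. by case=> w v; rewrite /sd_mul /= mul1g /gl_fun linear0 add0r. Qed.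
Fact sd_mulr1 : right_id sd_one sd_mul.
Proof. by case=> w v; rewrite /sd_mul /= mulg1 invg1 sd_act1 addr0. Qed.
Fact sd_mulV : left_inverse sd_one sd_inv sd_mul.
Proof.
case=> w v; rewrite /sd_mul /= mulVg; congr pair.
by rewrite {1}/gl_fun linearN /= -/(gl_fun _ _) -sd_actM mulVg sd_act1 addNr.
Qed.
Fact sd_mulrV : right_inverse sd_one sd_inv sd_mul.
Proof. by case=> w v; rewrite /sd_mul /= mulgV invgK addrN. Qed.

HB.instance Definition _ :=
  isGroup.Build T sd_mulA sd_mul1 sd_mulr1 sd_mulV sd_mulrV.

End SemiDirect.

Section Forms.
Variables (R : realType) (V : vectType R).
Implicit Types (A : set V) (E : {vspace V}).

Definition Zspan A : set V :=
  [set v | exists (k : nat) (x : 'I_k -> V) (c : 'I_k -> int),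
     (forall i, A (x i)) /\ v = \sum_(i < k) x i *~ c i].

Definition Rspan A : set V :=
  [set v | exists (k : nat) (x : 'I_k -> V) (c : 'I_k -> R),
     (forall i, A (x i)) /\ v = \sum_(i < k) c i *: x i].

Definition is_lattice E (L : set V) : Prop :=
  exists X : seq V, basis_of E X /\ L = Zspan [set` X].

Variable B : {symmetric V}.

Definition radical : set V := [set v | forall u, B v u = 0].

Definition refl (al v : V) : V := v - (2 * B al v / B al al) *: al.

Definition orth_spaces (E F : {vspace V}) : Prop :=
  forall u v, u \in E -> v \in F -> B u v = 0.

Definition orthogonal_sum (E F G : {vspace V}) : Prop :=
  [/\ (E + F + G)%VS = fullv, directv (E + F + G),
      orth_spaces E F, orth_spaces E G & orth_spaces F G].

Definition hyperbolic_pair (x y : V) : Prop :=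
  [/\ B x x = 0, B y y = 0 & B x y = 1].

Definition gram (X : seq V) : 'M[R]_(size X) :=
  \matrix_(i, j) B X`_i X`_j.

End Forms.

(* Eigenvalues are counted with multiplicity. *)
Definition mx_signature (R : realType) (k : nat) (A : 'M[R]_k) (p q z : nat)
  : Prop :=
  exists r : seq R,
    [/\ char_poly A = \prod_(x <- r) ('X - x%:P),
        count (fun x => 0 < x) r = p,
        count (fun x => x < 0) r = q
      & count (fun x => x == 0) r = z].

Definition form_signature (R : realType) (V : vectType R) (B : {symmetric V})
    (p q z : nat) : Prop :=
  exists X : seq V, basis_of fullv X /\ mx_signature (gram B X) p q z.

Section RootSystems.
Variables (R : realType) (V : vectType R) (B : {symmetric V}).
Implicit Types (Phi Psi : set V) (E : {vspace V}).

(* [Phi] is a generalized root system in the space [E], with the restriction *)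
(* of [B] to [E] as its form.                                                *)
Record gen_root_system E Phi : Prop := GenRootSystem {
  grs_nonempty : Phi !=set0;
  grs_anisotropic : forall al, Phi al -> B al al != 0;
  grs_span : Rspan Phi = [set` E];
  grs_refl : forall al be, Phi al -> Phi be -> Phi (refl B al be);
  grs_int : forall al be, Phi al -> Phi be ->
    2 * B al be / B be be \is a Num.int;
  grs_lattice : is_lattice E (Zspan Phi) }.

Definition reduced Phi : Prop :=
  forall al (r : R), Phi al -> Phi (r *: al) -> r = 1 \/ r = -1.

Definition irreducible Phi : Prop :=
  ~ exists (E1 E2 : {vspace V}) (Phi1 Phi2 : set V),
      [/\ gen_root_system E1 Phi1, gen_root_system E2 Phi2,
          Phi = Phi1 `|` Phi2
        & forall al be, Phi1 al -> Phi2 be -> B al be = 0].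

Definition elliptic n Phi : Prop :=
  [/\ gen_root_system fullv Phi, irreducible Phi, reduced Phi
    & form_signature B n 0 2].

Definition root_basis Psi (k : nat) (be : 'I_k -> V) : Prop :=
  [/\ free [seq be i | i : 'I_k],
      forall i, Psi (be i)
    & forall g, Psi g -> exists c : 'I_k -> nat,
        g = \sum_i be i *+ c i \/ g = - \sum_i be i *+ c i].

End RootSystems.

(* The quotient [V / U] is given by a surjective linear map [pi : V -> Q]    *)
(* with kernel [U], and [formQ] is the form induced on it.                   *)
Record tubular (R : realType) := Tubular {
  tub_V : vectType R;
  tub_form : {symmetric tub_V};
  tub_Phi : set tub_V;
  tub_n : nat;
  tub_elliptic : elliptic tub_form tub_n tub_Phi;
  tub_norm : forall al, tub_Phi al -> tub_form al al = 2;
  tub_U : {vspace tub_V};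
  tub_a : tub_V;
  tub_U_dim : \dim tub_U = 1%N;
  tub_U_rad : [set` tub_U] `<=` radical tub_form;
  tub_U_lattice : [set` tub_U] `&` Zspan tub_Phi <> [set 0];
  tub_a_span : Zspan tub_Phi `&` [set` tub_U] = Zspan [set tub_a];
  tub_Q : vectType R;
  tub_pi : 'Hom(tub_V, tub_Q);
  tub_pi_ker : lker tub_pi = tub_U;
  tub_pi_img : limg tub_pi = fullv;
  tub_formQ : {symmetric tub_Q};
  tub_formQE : forall u v, tub_formQ (tub_pi u) (tub_pi v) = tub_form u v;
  tub_beta : 'I_tub_n.+1 -> tub_Q;
  tub_beta_basis : root_basis (tub_pi @` tub_Phi) tub_beta;
  tub_beta_fin : exists (E : {vspace tub_Q}) (Psi : set tub_Q),
    [/\ Psi `<=` tub_pi @` tub_Phi, finite_set Psi,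
        gen_root_system tub_formQ E Psi
      & root_basis Psi (fun i : 'I_tub_n => tub_beta (lift ord0 i))];
  tub_m : 'I_tub_n.+1 -> nat;
  tub_m0 : tub_m ord0 = 1%N;
  tub_m_pos : forall i, (0 < tub_m i)%N;
  tub_m_span : Zspan [set \sum_i tub_beta i *+ tub_m i] =
    Zspan (tub_pi @` tub_Phi) `&` (tub_pi @` radical tub_form);
  tub_alpha : 'I_tub_n.+1 -> tub_V;
  tub_alpha_root : forall i, tub_Phi (tub_alpha i);
  tub_alphaE : forall i, tub_pi (tub_alpha i) = tub_beta i;
  tub_t : 'I_tub_n.+1;
  tub_t_max : forall i, (tub_m i <= tub_m tub_t)%N;
  tub_t_uniq : forall i, tub_m i = tub_m tub_t -> i = tub_t }.

Section TubularDefs.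
Variables (R : realType) (T : tubular R).

Definition tub_b : tub_V T := \sum_i tub_alpha i *+ tub_m i.

Definition tub_Vfin : {vspace tub_V T} :=
  <<[seq tub_alpha (lift ord0 i) | i : 'I_(tub_n T)]>>%VS.

(* The index set M; [None] stands for the additional index t*.               *)
Definition tub_alphaM (i : option 'I_(tub_n T).+1) : tub_V T :=
  if i is Some j then tub_alpha j else tub_alpha (tub_t T) + tub_a T.

Record hyperbolic_cover := HyperbolicCover {
  cov_V : vectType R;
  cov_form : {symmetric cov_V};
  cov_inc : 'Hom(tub_V T, cov_V);
  cov_inc_inj : lker cov_inc = 0%VS;
  cov_inc_form : forall u v, cov_form (cov_inc u) (cov_inc v) = tub_form T u v;
  cov_a' : cov_V;
  cov_b' : cov_V;
  cov_pair_a : hyperbolic_pair cov_form (cov_inc (tub_a T)) cov_a';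
  cov_pair_b : hyperbolic_pair cov_form (cov_inc tub_b) cov_b';
  cov_sum : orthogonal_sum cov_form (cov_inc @: tub_Vfin)
    <<[:: cov_inc (tub_a T); cov_a']>> <<[:: cov_inc tub_b; cov_b']>> }.

Variable H : hyperbolic_cover.

Definition cov_Vtilde : {vspace cov_V H} :=
  (limg (cov_inc H) + <[cov_b' H]>)%VS.

Definition cover_gens : set (GL (subvs_of cov_Vtilde)) :=
  [set g | exists i : option 'I_(tub_n T).+1, forall v : subvs_of cov_Vtilde,
     vsval (gl_fun g v) =
       refl (cov_form H) (cov_inc H (tub_alphaM i)) (vsval v)].

Definition cover_system : gen_system :=
  GenSystem (generated cover_gens) cover_gens.

End TubularDefs.

(* The value 0 encodes an infinite entry. *)
Definition coxeter_matrix (k : nat) (m : 'I_k -> 'I_k -> nat) : Prop :=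
  [/\ forall i, m i i = 1%N, forall i j, m i j = m j i
    & forall i j, i != j -> m i j != 1%N].

(* [W] is presented by the generators [s i] and the relations                *)
(* [(s i s j) ^ m i j = 1].                                                  *)
Definition coxeter_system (k : nat) (m : 'I_k -> 'I_k -> nat) (W : groupType)
    (s : 'I_k -> W) : Prop :=
  [/\ coxeter_matrix m,
      generated (range s) = setT,
      forall i j, ((s i * s j) ^+ m i j)%g = 1%g
    & forall (G : groupType) (f : 'I_k -> G),
        (forall i j, ((f i * f j) ^+ m i j)%g = 1%g) ->
        exists phi : {multiplicative W -> G}, forall i, phi (s i) = f i].

Section Graphs.
Variables (k : nat) (e : rel 'I_k).

Definition degree (i : 'I_k) : nat := #|[pred j | e i j]|.

Definition is_tree : Prop :=
  [/\ (0 < k)%N, forall i j, connect e i j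
    & forall c : seq 'I_k, ucycle e c -> (size c <= 2)%N].

Definition is_star : Prop :=
  is_tree /\ forall i j, (2 < degree i)%N -> (2 < degree j)%N -> i = j.

End Graphs.

Definition diagram (k : nat) (m : 'I_k -> 'I_k -> nat) : rel 'I_k :=
  fun i j => (i != j) && (m i j != 2%N).

Definition simple_bonds (k : nat) (m : 'I_k -> 'I_k -> nat) : Prop :=
  forall i j, diagram m i j -> m i j = 3%N.

Section StandardRep.
Variables (R : realType) (k : nat) (m : 'I_k -> 'I_k -> nat).

(* The matrix of the form -2 cos (pi / m i j) for a diagram that has only    *)
(* simple bonds.                                                             *)
Definition cartan : 'M[R]_k :=
  \matrix_(i, j) (if i == j then 2 else if diagram m i j then -1 else 0).

Definition simple_root (i : 'I_k) : 'rV[R]_k := delta_mx 0 i.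

Definition std_form (u v : 'rV[R]_k) : R := (u *m cartan *m v^T) 0 0.

Variables (W : groupType) (s : 'I_k -> W).

Definition standard_rep (rho : {multiplicative W -> GL 'rV[R]_k}) : Prop :=
  forall i v, gl_fun (rho (s i)) v =
    v - std_form (simple_root i) v *: simple_root i.

Definition cox_roots (rho : {multiplicative W -> GL 'rV[R]_k}) : set 'rV[R]_k :=
  [set v | exists w i, v = gl_fun (rho w) (simple_root i)].

End StandardRep.

(* The representation [ext_rho] is determined by [ext_rhoP]; it exists by    *)
(* the presentation of [ext_W].                                              *)
Record ext_coxeter (R : realType) := ExtCoxeter {
  ext_k : nat;
  ext_m : 'I_ext_k -> 'I_ext_k -> nat;
  ext_W : groupType;
  ext_s : 'I_ext_k -> ext_W;
  ext_presented : coxeter_system ext_m ext_s;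
  ext_simple : simple_bonds ext_m;
  ext_star : is_star (diagram ext_m);
  ext_rho : {multiplicative ext_W -> GL 'rV[R]_ext_k};
  ext_rhoP : standard_rep ext_m ext_s ext_rho;
  ext_t : 'I_ext_k;
  ext_t_max : forall i,
    (degree (diagram ext_m) i <= degree (diagram ext_m) ext_t)%N }.

Section ExtCoxeterDefs.
Variables (R : realType) (E : ext_coxeter R).

Definition ext_group : set (semidirect (@ext_rho R E)) :=
  [set x | Zspan (cox_roots (@ext_rho R E)) x.2].

Definition ext_gens : set (semidirect (@ext_rho R E)) :=
  [set x | (exists i, x = (ext_s i, 0))
         \/ x = (ext_s (ext_t E), simple_root R (ext_t E))].

Definition ext_system : gen_system := GenSystem ext_group ext_gens.

(* The diagram is affine if the form of the standard representation has the  *)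
(* signature of an affine root system.                                       *)
Definition affine_diagram : Prop :=
  mx_signature (cartan R (@ext_m R E)) (ext_k E).-1 0 1.

End ExtCoxeterDefs.

(* Main.v *)
From HB Require Import structures.
Require Import Defs.
From mathcomp Require Import all_boot all_order all_algebra.
From mathcomp Require Import mathcomp_extra boolp classical_sets functions.
From mathcomp Require Import cardinality reals.
From mathcomp Require Import spectral complex.
From mathcomp Require Import zify ring lra.

Set Implicit Arguments.
Unset Strict Implicit.
Unset Printing Implicit Defensive.

Import Order.TTheory GRing.Theory Num.Theory.
Local Open Scope classical_set_scope.
Local Open Scope ring_scope.

(** Both directions rest on one computation. Let a simply laced Coxeter group W
with connected diagram act on a space with a symmetric form by reflections in
independent vectors al_i whose Gram matrix is the Cartan matrix, and let a be a
radical vector. For l in the root lattice the maps T_l v = v - (l | v) a are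
permuted by W under conjugation as the vectors l are by W, and s_t T_(al_t) is
the reflection in al_t + a. So (w, l) |-> w T_l carries the extended Coxeter
group onto the group generated by the reflections in the al_i and in al_t + a,
and carries generators to generators [core_isomorphism]. On the hyperbolic
cover it is injective [cover_isomorphism]: on W by the theorem of Tits, and on
the lattice because an integral vector that is radical in V is a multiple of b,
which the product with b' detects.

The theorem of Tits is proved for any group whose generators satisfy the
Coxeter relations and which acts by the standard representation [root_nonneg,
tits_faithful]. Applied to a product G x GL it shows that the reflection group
of the standard representation has the Coxeter presentation, which provides the
Coxeter groups needed [coxeter_group_exists].

From a cover to an extended Coxeter system it then remains to see that the Gram
matrix of the affine simple roots is the Cartan matrix of a star centred at t.
The integral kernel of this matrix is spanned by the marks, which have a unique
maximum, and every nonnegative vector that the matrix makes nonpositive on its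
support is a multiple of the marks [subharmonic_max]. A multiple bond, a cycle
and a second branch vertex each support such a vector with two maxima.

From an affine star to a tubular system one needs the marks. The signature
makes the Cartan matrix semidefinite with a kernel, and the absolute values of
an integral kernel vector are positive marks [affine_marks]. Along each leg of
the star they decrease arithmetically from the centre to a last mark x, and the
proper divisors x of the central mark M add up to (d - 2) M, where d is the
valence. This equation forces one x to divide all marks [mark_dvd_all];
dividing by it one finds a vertex of mark 1, which becomes the affine node,
while the centre is the only vertex of maximal mark [mark_uniq]. The roots of
the tubular system are then the pairs of a root of W and an integer, in the
space R^k + R a [affine_tubular, affine_cover]. *)

(** * Diagrams and marks *)

Lemma connect_ind (k : nat) (e : rel 'I_k) (P : 'I_k -> Prop) i0 :
  (forall i j, connect e i j) -> P i0 -> (forall i j, e i j -> P i -> P j) ->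
  forall j, P j.
Proof.
move=> econ Pi0 Pe j; have /connectP[p pe ->] := econ i0 j.
elim: p i0 Pi0 pe => //= x p IHp i Pi /andP[eix] /IHp; apply.
exact: Pe Pi.
Qed.

(** The shape of a simple path that the test vector of [branch_uniq] uses: an
end has a neighbour on the path, an inner vertex has two. *)
Lemma two_path (k : nat) (e : rel 'I_k) u p v :
  path e u p -> v = last u p -> u != v ->
  uniq (u :: p) -> symmetric e ->
  [/\ exists2 y, y \in u :: p & e u y, exists2 y, y \in u :: p & e v y
    & forall x, x \in u :: p -> x != u -> x != v ->
      exists y z, [/\ y != z, y \in u :: p, z \in u :: p, e x y & e x z]].
Proof.
move=> pe vE uv up esym; split.
- case: p pe vE uv up => [|y p] /=; first by move=> _ ->; rewrite eqxx.
  by case/andP=> euy _ _ _ _; exists y; rewrite // !inE eqxx orbT.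
- case/lastP: p pe vE uv up => [|p y]; first by move=> _ ->; rewrite eqxx.
  rewrite rcons_path last_rcons => /andP[_ ey] -> _ _.
  exists (last u p); last by rewrite esym.
  by rewrite -rcons_cons mem_rcons inE mem_last orbT.
move=> x xp xu xv; move: xp; rewrite inE (negPf xu) /=.
move=> xp; case/splitPr: xp pe vE up => p1 p2.
rewrite cat_path last_cat => /and3P[_ e1 pe2] vE up.
case: p2 pe2 vE up => [|z p2]; first by move=> _ vE; rewrite vE /= eqxx in xv.
case/andP=> exz _ _.
rewrite -cat_cons cat_uniq => /andP[_ /andP[dis _]].
exists (last u p1), z; split; rewrite // 1?esym //.
- apply/eqP => eqz; case/negP: dis; apply/orP; right; apply/orP; left.
  by rewrite -eqz mem_last.
- by have := mem_last u p1; rewrite !inE mem_cat => /orP[]->; rewrite ?orbT.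
- by rewrite inE mem_cat !inE eqxx !orbT.
Qed.

Lemma degree_other (k : nat) (e : rel 'I_k) u y : (2 < degree e u)%N -> e u y ->
  exists z w, [/\ uniq [:: y; z; w], e u z & e u w].
Proof.
rewrite /degree => du euy.
have : (1 < #|[predD1 [pred j | e u j] & y]|)%N.
  by move: du; rewrite (cardD1 y) inE euy.
case/card_gt1P=> z [w [/andP[zy zu] /andP[wy wu] zw]].
by exists z, w; split; rewrite //= !inE negb_or eq_sym zy eq_sym wy zw.
Qed.

(** ** The diagram of an affine Gram matrix with one maximal mark *)

Section AffineMarks.
Variables (k : nat) (a : 'I_k -> 'I_k -> int) (m : 'I_k -> nat) (t : 'I_k).
Hypothesis a_diag : forall i, a i i = 2.
Hypothesis a_sym : forall i j, a i j = a j i.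
Hypothesis a_off : forall i j, i != j -> a i j <= 0.
Hypothesis m_gt0 : forall i, (0 < m i)%N.
Hypothesis m_ker : forall i, \sum_j a i j * (m j)%:Z = 0.
Hypothesis ker_m : forall f : 'I_k -> int,
  (forall i, \sum_j a i j * f j = 0) ->
  exists c : int, forall i, f i = c * (m i)%:Z.
Hypothesis m_max : forall i, (m i <= m t)%N.
Hypothesis m_uniq : forall i, m i = m t -> i = t.

Definition bond : rel 'I_k := fun i j => (i != j) && (a i j != 0).
Arguments bond : simpl never.

Lemma bond_sym : symmetric bond.
Proof. by move=> i j; rewrite /bond eq_sym a_sym. Qed.

Lemma bond_irr : irreflexive bond.
Proof. by move=> i; rewrite /bond eqxx. Qed.

Lemma bond_le i j : bond i j -> a i j <= -1.
Proof. by case/andP=> /a_off aij nz; lia. Qed.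

(** The tool that excludes every wrong diagram.  If f >= 0 and the vector A f is
nonpositive on the support of f, then it is nonpositive everywhere, because A
has nonpositive entries off the diagonal; as A is symmetric with positive
kernel vector m, the pairing of A f with m vanishes, hence A f = 0 and f is a
multiple of m, whose maximum is attained at t only.  So it suffices to exhibit
such an f with two maxima. *)
Lemma subharmonic_max (f : 'I_k -> int) (i : 'I_k) :
  (forall j, 0 <= f j) -> (exists j, f j != 0) ->
  (forall j, 0 < f j -> \sum_l a j l * f l <= 0) ->
  (forall j, f j <= f i) -> i = t.
Proof.
move=> f_ge0 [j0 fj0] f_sub f_max.
have Af_le0 j : \sum_l a j l * f l <= 0.
  have [fj|] := ltP 0 (f j); first exact: f_sub.
  move=> fj_le0; rewrite (bigD1 j) //=.
  have -> : f j = 0 by apply/le_anti; rewrite fj_le0 f_ge0.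
  rewrite mulr0 add0r; apply: sumr_le0 => l lj.
  by rewrite mulr_le0_ge0 // a_off // eq_sym.
have Am_f : \sum_j (m j)%:Z * (- \sum_l a j l * f l) = 0.
  under eq_bigr do rewrite mulrN.
  rewrite sumrN; apply/eqP; rewrite oppr_eq0; apply/eqP.
  under eq_bigr do rewrite big_distrr /=.
  rewrite exchange_big /=; apply: big1 => l _.
  transitivity (f l * \sum_j a l j * (m j)%:Z); last by rewrite m_ker mulr0.
  by rewrite big_distrr /=; apply: eq_bigr => j _; rewrite (a_sym j l); ring.
have Af0 j : \sum_l a j l * f l = 0.
  have /psumr_eq0P/(_ Am_f j isT)/eqP : forall j, true ->
    0 <= (m j)%:Z * (- \sum_l a j l * f l).
    by move=> l _; rewrite mulr_ge0 // oppr_ge0.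
  by rewrite mulf_eq0 oppr_eq0 => /orP[|/eqP//]; have := m_gt0 j; lia.
have [c fE] := ker_m Af0.
have c_gt0 : 0 < c.
  have := f_ge0 j0; have := fj0; have := m_gt0 j0; rewrite fE => *; nia.
apply: m_uniq; have := f_max t; rewrite !fE ler_pM2l //.
by have := m_max i; lia.
Qed.

Lemma row_bound (f : 'I_k -> int) i (s : seq 'I_k) :
  (forall j, 0 <= f j) -> uniq s -> all (bond i) s ->
  \sum_j a i j * f j <= 2 * f i - \sum_(j <- s) f j.
Proof.
move=> f_ge0 us /allP bs; rewrite (bigD1 i) //= a_diag lerD2l.
rewrite (bigID [pred j | j \in s]) /= -sumrN (big_uniq _ us) /=.
rewrite -[leRHS]addr0 lerD //.
  rewrite (eq_bigl (mem s)) => [|j /=].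
    apply: ler_sum => j js; have := bond_le (bs _ js); have := f_ge0 j; nia.
  have [js|] := boolP (j \in s); last by rewrite andbF.
  by rewrite andbT eq_sym; have /andP[] := bs _ js.
apply: sumr_le0 => j /andP[ji _].
by rewrite mulr_le0_ge0 // a_off // eq_sym.
Qed.

(** Test vector: the indicator of a bond of weight at least two. *)
Lemma bond_eqN1 i j : bond i j -> a i j = -1.
Proof.
move=> bij; have /andP[nij _] := bij.
have [|aij2] := ltP (-2) (a i j); first by have := bond_le bij; lia.
pose f l : int := ((l == i) || (l == j))%:R.
have f_le1 l : f l <= 1 by rewrite /f; case: (_ || _).
have f_ge0 l : 0 <= f l by rewrite /f; case: (_ || _).
have fi : f i = 1 by rewrite /f eqxx.
have fj : f j = 1 by rewrite /f eqxx orbT.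
have sub l : 0 < f l -> \sum_x a l x * f x <= 0.
  suff key u v : u != v -> a u v <= -2 -> f u = 1 -> f v = 1 ->
      \sum_x a u x * f x <= 0.
    have [->|li] := eqVneq l i; first by move=> _; apply: (key i j).
    have [->|lj] := eqVneq l j; last by rewrite /f (negPf li) (negPf lj).
    by move=> _; apply: (key j i); rewrite // 1?eq_sym // a_sym.
  move=> uv auv fu fv; rewrite (bigD1 u) //= (bigD1 v) 1?eq_sym //= a_diag fu
    fv.
  rewrite addrA -[leRHS]addr0 lerD //; first lia.
  apply: sumr_le0 => x /andP[xu _]; rewrite mulr_le0_ge0 // a_off //.
  by rewrite eq_sym.
have nz : exists l, f l != 0 by exists i; rewrite fi.
have it : i = t by apply: (subharmonic_max f_ge0 nz sub) => l; rewrite fi.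
have jt : j = t by apply: (subharmonic_max f_ge0 nz sub) => l; rewrite fj.
by rewrite it jt eqxx in nij.
Qed.

(** The restriction of the marks to a connected component is again in the
kernel, hence a multiple of the marks. *)
Lemma bond_connected i j : connect bond i j.
Proof.
have csym := sym_connect_sym bond_sym.
pose f l : int := if connect bond t l then (m l)%:Z else 0.
have [x|c fE] := ker_m (f := f).
  have [tx|ntx] := boolP (connect bond t x); last first.
    apply: big1 => l _; rewrite /f; case: ifP => [tl|]; last by rewrite mulr0.
    suff -> : a x l = 0 by rewrite mul0r.
    apply/eqP/negPn/negP => axl; case/negP: ntx.
    have [<-//|nxl] := eqVneq l x.
    apply: connect_trans tl (connect1 _).
    by rewrite /bond nxl a_sym.
  rewrite -[RHS](m_ker x); apply: eq_bigr => l _; rewrite /f.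
  case: ifP => // ntl; rewrite mulr0.
  suff -> : a x l = 0 by rewrite mul0r.
  apply/eqP/negPn/negP => axl; case/negP: (negbT ntl).
  have [->//|nxl] := eqVneq l x.
  by apply: connect_trans tx (connect1 _); rewrite /bond eq_sym nxl.
have c1 : c = 1.
  have := fE t; rewrite /f connect0; have := m_gt0 t; nia.
have tcon l : connect bond t l.
  have := fE l; rewrite /f c1; case: ifP => // _; have := m_gt0 l; lia.
by rewrite (connect_trans _ (tcon j)) // csym.
Qed.

(** Test vector: the indicator of a cycle. *)
Lemma bond_acyclic c : ucycle bond c -> (size c <= 2)%N.
Proof.
case/andP=> cyc uc; rewrite leqNgt; apply/negP => sz.
have [x1 [x2 [xc yc xy]]] : exists x y, [/\ x \in c, y \in c & x != y].
  case: c uc sz {cyc} => [|x [|y c]] //= /andP[xyc _] _; exists x, y.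
  by rewrite !inE !eqxx orbT; split=> //; case: eqP xyc => // ->;
    rewrite inE eqxx.
pose f l : int := (l \in c)%:R.
have f_ge0 l : 0 <= f l by rewrite /f; case: (_ \in _).
have f_le1 l : f l <= 1 by rewrite /f; case: (_ \in _).
have sub l : 0 < f l -> \sum_x a l x * f x <= 0.
  rewrite {1}/f; case: (boolP (l \in c)) => // lc _.
  have [i c' cE] := rot_to lc.
  move: cyc uc sz; rewrite -(rot_cycle i) -(rot_uniq i) -(size_rot i) cE.
  case: c' cE => [|y c'] //; case/lastP: c' => [|c' z] //= cE.
  rewrite rcons_path last_rcons => /andP[ly /andP[_ zl]].
  rewrite !mem_rcons !inE => /and3P[_ /norP[yz _] _] _.
  have mc x : x \in [:: l, y & rcons c' z] -> f x = 1.
    by rewrite -cE mem_rot /f => ->.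
  have := @row_bound f l [:: y; z] f_ge0.
  rewrite /= inE yz ly bond_sym zl 2!big_cons big_nil => /(_ isT isT).
  by rewrite !mc ?(inE, mem_rcons, eqxx, orbT).
have fx : f x1 = 1 by rewrite /f xc.
have fy : f x2 = 1 by rewrite /f yc.
have nz : exists l, f l != 0 by exists x1; rewrite fx.
have xt : x1 = t by apply: (@subharmonic_max f) => // l; rewrite fx.
have yt : x2 = t by apply: (@subharmonic_max f) => // l; rewrite fy.
by rewrite xt yt eqxx in xy.
Qed.

(** Test vector: 2 on a path between two vertices of degree at least 3 and 1 on
the other neighbours of these two, modelled on the null root of an affine
diagram of type D. *)
Lemma branch_uniq i j : (2 < degree bond i)%N -> (2 < degree bond j)%N -> i = j.
Proof.
move=> di dj; apply/eqP/negPn/negP => nij.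
have /connectP[q qe jE] := bond_connected i j.
case: (shortenP qe) jE => p pe up _ jE {q qe}.
have [[yi yip eyi] [yj yjp eyj] inner] := two_path pe jE nij up bond_sym.
pose f l : int := if l \in i :: p then 2 else
  if bond i l || bond j l then 1 else 0.
have f_ge0 l : 0 <= f l by rewrite /f; do ?case: ifP.
have f_le2 l : f l <= 2 by rewrite /f; do ?case: ifP.
have f_path l : l \in i :: p -> f l = 2 by rewrite /f => ->.
have f_nbr l : bond i l || bond j l -> 1 <= f l.
  by rewrite /f; case: ifP => // _ ->.
have jp : j \in i :: p by rewrite jE mem_last.
have ip : i \in i :: p by rewrite inE eqxx.
have endp u y : u \in i :: p -> (2 < degree bond u)%N -> y \in i :: p ->
    bond u y -> (forall l, bond u l -> 1 <= f l) ->
    \sum_x a u x * f x <= 0.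
  move=> pu du py buy fu; have [z [w [uyzw uz uw]]] := degree_other du buy.
  have := @row_bound f u [:: y; z; w] f_ge0 uyzw.
  rewrite /= buy uz uw 3!big_cons big_nil (f_path _ pu) (f_path _ py).
  move=> /(_ isT); move: (fu _ uz) (fu _ uw).
  by move: (f z) (f w) (\sum_x _) => fz fw s; clear; lia.
have sub l : 0 < f l -> \sum_x a l x * f x <= 0.
  have [lp _|lp] := boolP (l \in i :: p).
    have [->|li] := eqVneq l i.
      by apply: (endp i yi) => // x bx; apply: f_nbr; rewrite bx.
    have [->|lj] := eqVneq l j.
      by apply: (endp j yj) => // x bx; apply: f_nbr; rewrite bx orbT.
    have [y [z [yz yp zp ly lz]]] := inner l lp li lj.
    have := @row_bound f l [:: y; z] f_ge0.
    rewrite /= inE yz ly lz 2!big_cons big_nil => /(_ isT isT).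
    by rewrite !f_path.
  rewrite {1}/f (negPf lp); case: ifP => // bl _.
  have [u [pu blu]] : exists u, u \in i :: p /\ bond l u.
    by case/orP: bl => ?; [exists i | exists j]; rewrite bond_sym.
  have := @row_bound f l [:: u] f_ge0.
  rewrite /= blu big_cons big_nil => /(_ isT isT).
  by rewrite (f_path u) // {2}/f (negPf lp) bl.
have nz : exists l, f l != 0 by exists i; rewrite f_path.
have it : i = t by apply: (subharmonic_max f_ge0 nz sub) => l;
  rewrite (f_path i).
have jt : j = t by apply: (subharmonic_max f_ge0 nz sub) => l;
  rewrite (f_path j).
by rewrite it jt eqxx in nij.
Qed.

Lemma marks_harmonic i : (2 * m i = \sum_(j | bond i j) m j)%N.
Proof.
have := m_ker i; rewrite (bigD1 i) //= a_diag (bigID (bond i)) /=.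
rewrite [X in _ + (_ + X)]big1 => [|j /andP[ji]]; last first.
  by rewrite /bond eq_sym ji /= negbK => /eqP->; rewrite mul0r.
rewrite addr0 (eq_bigl (bond i)) => [|j]; last first.
  by rewrite /bond eq_sym; case: eqP.
rewrite (eq_bigr (fun j => - (m j)%:Z)) => [|j /bond_eqN1 ->]; last first.
  by rewrite mulN1r.
rewrite sumrN -(big_morph Posz PoszD (erefl (Posz 0))).
by move: (\sum_(j | _) _)%N => s; clear; lia.
Qed.

(** At a vertex of degree at most 2 the mark is at most the mean of its
neighbours, which a strict maximum forbids. *)
Lemma degree_max_mark : (2 < degree bond t)%N.
Proof.
rewrite ltnNge; apply/negP => dt.
have lt j : bond t j -> (m j < m t)%N.
  move=> btj; rewrite ltn_neqAle m_max andbT; apply/eqP => /m_uniq jt.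
  by rewrite jt bond_irr in btj.
have : (\sum_(j | bond t j) (m j).+1 <= degree bond t * m t)%N.
  by rewrite /degree -sum_nat_const; apply: leq_sum.
have -> : (\sum_(j | bond t j) (m j).+1 =
           degree bond t + \sum_(j | bond t j) m j)%N.
  by rewrite /degree -sum1_card -big_split.
rewrite -marks_harmonic; have := m_gt0 t.
by move: (degree _ _) dt => [|[|[|d]]] //; lia.
Qed.

Lemma bond_star : is_star bond.
Proof.
split; last exact: branch_uniq.
by split; [exact: leq_ltn_trans (leq0n t) (ltn_ord t) | exact: bond_connected
  | exact: bond_acyclic].
Qed.

Lemma degree_max i : (degree bond i <= degree bond t)%N.
Proof.
have [di|di] := ltnP 2 (degree bond i); last first.
  by apply: leq_trans di (ltnW degree_max_mark).
by rewrite (branch_uniq di degree_max_mark).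
Qed.

End AffineMarks.
(** Leaving x0 through y0 and staying in P, a path can always be prolonged, as
each vertex has a neighbour other than the one it was reached from and no cycle
may close; a finite graph does not allow this. *)
Lemma acyclic_leaf (k : nat) (e : rel 'I_k) (P : 'I_k -> Prop) x0 y0 :
  symmetric e -> irreflexive e ->
  (forall c : seq 'I_k, ucycle e c -> (size c <= 2)%N) ->
  e x0 y0 -> P y0 ->
  (forall v, P v -> v != x0 ->
     (1 < degree e v)%N /\ forall w, e v w -> w != x0 -> P w) ->
  False.
Proof.
move=> esym eirr acyc e0 P0 Pe.
have long n : exists q v, [/\ size q = n, path e x0 (rcons q v),
    uniq (x0 :: rcons q v) & P v].
  elim: n => [|n [q [v [szq pq uq Pv]]]].
    exists [::], y0; split=> //=; rewrite ?e0 // inE andbT.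
    by case: eqP e0 => // ->; rewrite eirr.
  have vx0 : v != x0.
    by move: uq; rewrite cons_uniq mem_rcons inE eq_sym => /andP[/norP[]].
  have [dv Pw] := Pe v Pv vx0.
  have [w evw wu] : exists2 w, e v w & w != last x0 q.
    case/card_gt1P: dv => z1 [z2 [/= vz1 vz2 z12]].
    have [z1l|] := eqVneq z1 (last x0 q); last by exists z1.
    by exists z2 => //; rewrite -z1l eq_sym.
  have [wq|wq] := boolP (w \in x0 :: rcons q v); last first.
    exists (rcons q v), w; split; rewrite ?size_rcons ?szq //.
    - by rewrite rcons_path pq last_rcons.
    - by rewrite -rcons_cons rcons_uniq wq.
    - by apply: Pw => //; apply: contraNneq wq => ->; rewrite inE eqxx.
  have [s1 [s2 sE]] : exists s1 s2, x0 :: rcons q v = s1 ++ w :: s2.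
    by case/splitPr: wq => s1 s2; exists s1, s2.
  have vlast : last w s2 = v.
    by have /(congr1 (last x0)) := sE; rewrite last_cat /= last_rcons.
  have us2 : uniq (w :: s2) by move: uq; rewrite sE cat_uniq => /and3P[].
  have ps2 : path e w s2.
    case: s1 sE => [|y s1] [xE sE]; first by rewrite -xE -sE.
    by move: pq; rewrite sE cat_path => /andP[_ /andP[]].
  have /acyc : ucycle e (w :: s2).
    by rewrite /ucycle us2 /= rcons_path ps2 vlast evw.
  case/lastP: s2 sE vlast us2 ps2 => [|s2 y] sE /=.
    by move=> wv; rewrite wv eirr in evw.
  rewrite last_rcons => yv; rewrite {y}yv in sE *.
  case/lastP: s2 sE => [|s2 y] sE; last by rewrite !size_rcons.
  have : x0 :: q = rcons s1 w.
    by apply: (@rcons_injl _ v); rewrite rcons_cons sE -!cats1 -catA.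
  by move/(congr1 (last x0)); rewrite last_rcons /= => wE;
    rewrite wE eqxx in wu.
have [q [v [szq _ uq _]]] := long k.
have := max_card (mem (x0 :: rcons q v)).
by rewrite (card_uniqP uq) /= size_rcons szq card_ord; lia.
Qed.

(** The solutions of 1/p + 1/q + 1/r = 1 are (3, 3, 3), (2, 4, 4) and (2, 3, 6);
in each of them the least of the three divisors of M divides the other two. *)
Lemma sum_three_divisors (x y z M : nat) :
  (0 < x)%N -> (0 < y)%N -> (0 < z)%N ->
  (x %| M)%N -> (y %| M)%N -> (z %| M)%N ->
  (x + y + z = M)%N -> (x >= y)%N -> (y >= z)%N -> (z %| x)%N && (z %| y)%N.
Proof.
move=> x0 y0 z0 /dvdnP[p Mp] /dvdnP[q Mq] _ sE xy yz.
have p_le : (p <= 3)%N by nia.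
have p_ge : (2 <= p)%N by nia.
move: p p_le p_ge Mp => [|[|[|[|p]]]] // _ _ Mp; last first.
  have -> : x = z by lia.
  have -> : y = z by lia.
  by rewrite dvdnn.
have q_le : (q <= 4)%N by nia.
have q_ge : (3 <= q)%N by nia.
move: q q_le q_ge Mq => [|[|[|[|[|q]]]]] // _ _ Mq.
  have -> : x = (3 * z)%N by lia.
  have -> : y = (2 * z)%N by lia.
  by rewrite !dvdn_mull.
have -> : x = (2 * z)%N by lia.
have -> : y = z by lia.
by rewrite dvdn_mull // dvdnn.
Qed.

(** With d proper divisors that add up to (d - 2) M, a proper divisor being at
most M / 2, there are at most four of them; four are all equal to M / 2. *)
Lemma least_of_divisors (s : seq nat) M : (2 < size s)%N ->
  (forall x, x \in s -> [/\ (0 < x)%N, (x %| M)%N & (2 * x <= M)%N]) ->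
  (sumn s + 2 * M = size s * M)%N ->
  exists2 x, x \in s & forall y, y \in s -> (x %| y)%N.
Proof.
move=> sz sP sE.
have sum_le : (2 * sumn s <= size s * M)%N.
  elim: s {sz sE} sP => // x s IHs sP /=.
  have [_ _ xM] := sP x (mem_head _ _).
  have := IHs (fun y ys => sP y (mem_behead (s := x :: s) ys)); lia.
case: s sz sP sE sum_le => [|x [|y [|z s]]] //= _ sP sE sum_le.
have [x0 xM x2] : [/\ (0 < x)%N, (x %| M)%N & (2 * x <= M)%N].
  by apply: sP; rewrite !inE eqxx.
have [y0 yM y2] : [/\ (0 < y)%N, (y %| M)%N & (2 * y <= M)%N].
  by apply: sP; rewrite !inE eqxx ?orbT.
have [z0 zM z2] : [/\ (0 < z)%N, (z %| M)%N & (2 * z <= M)%N].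
  by apply: sP; rewrite !inE eqxx ?orbT.
case: s sP sE sum_le => [|w s] sP /= sE sum_le.
  have sM : (x + y + z = M)%N by lia.
  suff [u us uP] : exists2 u, u \in [:: x; y; z] &
      [&& u %| x, u %| y & u %| z]%N.
    exists u => // v; case/and3P: uP => ? ? ?.
    by rewrite !inE => /or3P[] /eqP->.
  have key u v w : (u + v + w = M)%N -> (0 < u)%N -> (0 < v)%N -> (0 < w)%N ->
      (u %| M)%N -> (v %| M)%N -> (w %| M)%N -> (w <= u)%N -> (w <= v)%N ->
      (w %| u)%N && (w %| v)%N.
    move=> uvw u0 v0 w0 uM vM wM wu wv.
    have [vu|/ltnW uv] := leqP v u; first exact: (@sum_three_divisors u v w M).
    by rewrite andbC; apply: (@sum_three_divisors v u w M) => //; lia.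
  have [/andP[zx zy]|nz] := boolP ((z <= x)%N && (z <= y)%N).
    have /andP[dx dy] := key x y z sM x0 y0 z0 xM yM zM zx zy.
    by exists z; rewrite ?inE ?eqxx ?orbT // dx dy dvdnn.
  have [xy|yx] := leqP x y.
    have /andP[dy dz] : (x %| y)%N && (x %| z)%N by apply: key => //; lia.
    by exists x; rewrite ?inE ?eqxx // dy dz dvdnn.
  have /andP[dx dz] : (y %| x)%N && (y %| z)%N by apply: key => //; lia.
  by exists y; rewrite ?inE ?eqxx ?orbT // dx dz dvdnn.
have [w0 wM w2] : [/\ (0 < w)%N, (w %| M)%N & (2 * w <= M)%N].
  by apply: sP; rewrite !inE eqxx ?orbT.
case: s sP sE sum_le => [|v s] sP /= sE sum_le; last first.
  exfalso; have M0 : (0 < M)%N by lia.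
  by move: sE sum_le; move: (sumn _) (size _) => a b; clear -M0; nia.
exists x; rewrite ?inE ?eqxx // => u us; have -> : u = x; last exact: dvdnn.
by move: us; rewrite !inE => /or4P[] /eqP->; lia.
Qed.

(** ** Harmonic marks on a star *)

Section StarMarks.
Variables (k : nat) (e : rel 'I_k) (m : 'I_k -> nat) (t : 'I_k).
Hypothesis e_sym : symmetric e.
Hypothesis e_irr : irreflexive e.
Hypothesis e_star : is_star e.
Hypothesis t_max : forall i, (degree e i <= degree e t)%N.
Hypothesis m_gt0 : forall i, (0 < m i)%N.
Hypothesis m_harm : forall i, (2 * m i = \sum_(j | e i j) m j)%N.

Let e_con : forall i j, connect e i j. Proof. by have [[]] := e_star. Qed.
Let e_acyc : forall c : seq 'I_k, ucycle e c -> (size c <= 2)%N.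
Proof. by have [[]] := e_star. Qed.

Lemma sum_degree_marks : (\sum_i degree e i * m i = \sum_i 2 * m i)%N.
Proof.
under [RHS]eq_bigr do rewrite m_harm.
rewrite [RHS](exchange_big_dep xpredT) //=; apply: eq_bigr => i _.
rewrite sum_nat_const /degree; congr (_ * _)%N; apply: eq_card => j.
by rewrite !inE e_sym.
Qed.

Lemma nbr_exists i : exists j, e i j.
Proof.
have [j eij|no] := pickP (e i); first by exists j.
by have := m_harm i; rewrite big_pred0 //; have := m_gt0 i; lia.
Qed.

(** If all degrees were at most 2, the degree sum would force all of them to be
2, and a tree has a leaf. *)
Lemma degree_center : (2 < degree e t)%N.
Proof.
rewrite ltnNge; apply/negP => dt.
have d2 i : degree e i = 2.
  have d_le j : (degree e j <= 2)%N := leq_trans (t_max j) dt.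
  have := sum_degree_marks => /eqP.
  have le j : true -> (degree e j * m j <= 2 * m j ?= iff (degree e j == 2))%N.
    move=> _; split; first by rewrite leq_mul2r d_le orbT.
    by rewrite eqn_pmul2r.
  by rewrite (leqif_sum le) => /forallP/(_ i)/eqP.
have [y ty] := nbr_exists t.
apply: (@acyclic_leaf k e (fun=> True) t y) => // v _ _.
by rewrite d2.
Qed.

Lemma degree_leg i : i != t -> (degree e i <= 2)%N.
Proof.
move=> it; rewrite leqNgt; apply: contra_neqN it => di.
by have [_] := e_star; apply => //; exact: degree_center.
Qed.

Lemma local_max i : i != t -> (forall j, e i j -> (m j <= m i)%N) ->
  (1 < degree e i)%N /\ forall j, e i j -> m j = m i.
Proof.
move=> it mle; have di := degree_leg it.
have le j : e i j -> (m j <= m i ?= iff (m j == m i))%N.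
  by move=> /mle ij; split.
have [s_le s_eq] := leqif_sum le; rewrite sum_nat_const -m_harm in s_le s_eq.
rewrite -/(degree e i) in s_le s_eq; have mi := m_gt0 i.
have d1 : degree e i = 2 by nia.
rewrite d1; split=> // j ij; move: s_eq; rewrite d1 eqxx => /esym/forall_inP.
by move/(_ j ij)/eqP.
Qed.

Lemma mark_le i : (m i <= m t)%N.
Proof.
have [j _ jmax] := @arg_maxnP _ t xpredT m isT.
suff -> : m t = m j by exact: jmax.
have [//|ntj] := eqVneq (m t) (m j).
apply: (connect_ind (P := fun l => m l = m j) e_con (erefl (m j))) =>
  l l' ll' mlj.
have lt : l != t by apply: contraNneq ntj => <-; apply/eqP.
have [_ ml] : (1 < degree e l)%N /\ forall j, e l j -> m j = m l.
  by apply: local_max => // x _; rewrite mlj; apply: jmax.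
by rewrite (ml _ ll').
Qed.

(** Maximality spreads along a leg, which would therefore have no end. *)
Lemma mark_nbr_lt j : e t j -> (m j < m t)%N.
Proof.
move=> tj; rewrite ltn_neqAle mark_le andbT; apply/eqP => mj.
apply: (@acyclic_leaf k e (fun v => m v = m t) t j) => // v mv vt.
have [d nb] : (1 < degree e v)%N /\ forall j, e v j -> m j = m v.
  by apply: local_max => // x _; rewrite mv mark_le.
by split=> // w vw _; rewrite (nb _ vw).
Qed.

Lemma mark_uniq i : m i = m t -> i = t.
Proof.
move=> mi; apply/eqP/negPn/negP => it.
suff [] : t != t /\ m t = m t by rewrite eqxx.
apply: (connect_ind (P := fun l => l != t /\ m l = m t) e_con (conj it mi)).
move=> j w jw [jt mj].
have [_ nb] : (1 < degree e j)%N /\ forall w, e j w -> m w = m j.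
  by apply: local_max => // x _; rewrite mj mark_le.
split; last by rewrite (nb _ jw).
apply: contraTneq jw => ->; rewrite e_sym; apply/negP => /mark_nbr_lt.
by rewrite mj ltnn.
Qed.

Lemma leg_step v u w : v != t -> e v u -> e v w -> w != u ->
  (2 * m v = m u + m w)%N.
Proof.
move=> vt vu vw wu; rewrite m_harm (bigD1 u) //= (bigD1 w) ?vw //=.
rewrite big_pred0 ?addn0 // => z; apply/negP => /andP[/andP[vz zu] zw].
have := degree_leg vt; rewrite /degree (cardD1 u) inE vu /= (cardD1 w).
by rewrite !inE vw wu (cardD1 z) !inE vz zu zw.
Qed.

Lemma leg_end v u : e v u -> (forall w, e v w -> w = u) -> (2 * m v = m u)%N.
Proof.
move=> vu one; rewrite m_harm (bigD1 u) //= big_pred0 ?addn0 // => z.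
by apply/negP => /andP[/one->]; rewrite eqxx.
Qed.

(** Marks decrease along a leg in arithmetic progression, and the last mark of
the leg is the common difference, since there 2 m v = m u. *)
Lemma leg_difference u v : e v u -> (m v < m u)%N ->
  (m u - m v %| m v)%N /\ exists i, m i = (m u - m v)%N.
Proof.
have [n] := ubnP (m v); elim: n u v => // n IHn u v le_n vu lt.
have vt : v != t.
  by apply: contraTneq lt => ->; rewrite -leqNgt mark_le.
have [w /andP[vw wu]|no] := pickP [pred w | e v w && (w != u)].
  have step := leg_step vt vu vw wu.
  have wv : (m w < m v)%N by lia.
  have -> : (m u - m v = m v - m w)%N by lia.
  rewrite e_sym in vw.
  have [|dv ex] := IHn v w _ vw wv; first lia.
  by split=> //; rewrite -[X in (_ %| X)%N](subnK (ltnW wv)) dvdn_addr.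
have eq2 : (2 * m v = m u)%N.
  apply: leg_end vu _ => w vw; apply/eqP; have := no w; rewrite /= vw /=.
  by move/negbFE.
have -> : (m u - m v = m v)%N by lia.
by rewrite dvdnn; split=> //; exists v.
Qed.

Lemma sum_center :
  (\sum_(j | e t j) (m t - m j) + 2 * m t = degree e t * m t)%N.
Proof.
rewrite m_harm -big_split /= /degree -sum_nat_const;
  apply: eq_bigr => j /mark_nbr_lt.
by move=> /ltnW /subnK.
Qed.

(** The differences along the legs at the centre t divide m t and add up to
(degree t - 2) m t, so that one of them divides all the others, and with m t
divides every mark of every leg; it is the mark at the end of its leg. *)
Lemma mark_dvd_all : exists i0, forall j, (m i0 %| m j)%N.
Proof.
pose N := enum [pred j | e t j]; pose s := [seq (m t - m j)%N | j <- N].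
have tdvd j : e t j -> (m t - m j %| m t)%N.
  move=> tj; have lt := mark_nbr_lt tj; rewrite e_sym in tj.
  have [dv _] := leg_difference tj lt.
  by rewrite -[X in (_ %| X)%N](subnK (ltnW lt)) dvdn_addr.
have sz : size s = degree e t by rewrite size_map -cardE.
have [|y||x xs xmin] := @least_of_divisors s (m t).
- by rewrite sz degree_center.
- case/mapP=> j; rewrite mem_enum inE => tj ->; rewrite tdvd //.
  have lt := mark_nbr_lt tj; have mj := m_gt0 j.
  have /dvdnP[q qE] := tdvd j tj; rewrite subn_gt0 lt; split=> //.
  have mt : (m t = (m t - m j) + m j)%N by lia.
  move: qE mt; move: (m t - m j)%N => d; move: (m t) => M.
  move: mj; case: q => [|[|q]]; move: (m j) => c c0 -> eqM.
  - by lia.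
  - by lia.
  - by rewrite leq_mul2r ltnS orbT.
- rewrite sz -sum_center; congr (_ + _)%N.
  by rewrite sumnE big_map big_enum.
have [j tj xE] : exists2 j, e t j & x = (m t - m j)%N.
  by case/mapP: xs => j; rewrite mem_enum inE => tj ->; exists j.
have xt : (x %| m t)%N by rewrite xE tdvd.
have lt := mark_nbr_lt tj.
have [_ [i0 i0E]] := leg_difference (etrans (e_sym j t) tj) lt.
have base w : e t w -> (x %| m w)%N.
  move=> tw; have ltw := mark_nbr_lt tw.
  have xw : (x %| m t - m w)%N.
    by apply: xmin; apply/mapP; exists w; rewrite ?mem_enum.
  by move: xt; rewrite -{1}(subnK (ltnW ltw)) dvdn_addr.
exists i0 => l; rewrite i0E -xE.
suff [] : (x %| m l)%N /\ forall w, e l w -> (x %| m w)%N by [].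
apply: (connect_ind (P := fun l => (x %| m l)%N /\
  forall w, e l w -> (x %| m w)%N) e_con (conj xt base)) => {}l w lw [xl xN].
have [->//|wt] := eqVneq w t; split=> [|z wz]; first exact: xN.
have [->//|zl] := eqVneq z l.
have := leg_step wt (etrans (e_sym w l) lw) wz zl => step.
have : (x %| m l + m z)%N by rewrite -step dvdn_mull // xN.
by rewrite dvdn_addr.
Qed.

End StarMarks.
(** * The standard form and the faithfulness of the standard representation *)

Section StandardForm.
Variables (R : realType) (k : nat) (m : 'I_k -> 'I_k -> nat).
Hypothesis m_sym : forall i j, m i j = m j i.

Lemma cartanC i j : cartan R m i j = cartan R m j i.
Proof. by rewrite !mxE /diagram eq_sym m_sym. Qed.

Lemma std_formE (u v : 'rV[R]_k) :
  std_form m u v = \sum_i \sum_j u 0 i * cartan R m i j * v 0 j.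
Proof.
rewrite /std_form mxE exchange_big /=; apply: eq_bigr => j _.
by rewrite !mxE big_distrl.
Qed.

Lemma std_formC (u v : 'rV[R]_k) : std_form m u v = std_form m v u.
Proof.
rewrite !std_formE exchange_big /=; apply: eq_bigr => j _.
by apply: eq_bigr => i _; rewrite cartanC; ring.
Qed.

Lemma std_formDl (c : R) (u v w : 'rV[R]_k) :
  std_form m (c *: u + v) w = c * std_form m u w + std_form m v w.
Proof. by rewrite /std_form mulmxDl -scalemxAl mulmxDl -scalemxAl !mxE. Qed.

Lemma std_formDr (c : R) (u v w : 'rV[R]_k) :
  std_form m w (c *: u + v) = c * std_form m w u + std_form m w v.
Proof. by rewrite std_formC std_formDl !(std_formC w). Qed.

Lemma std_form0l (v : 'rV[R]_k) : std_form m 0 v = 0.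
Proof. by rewrite /std_form !mul0mx mxE. Qed.

Lemma std_form_root i (v : 'rV[R]_k) :
  std_form m (simple_root R i) v = \sum_j cartan R m i j * v 0 j.
Proof.
by rewrite /std_form -rowE mxE; apply: eq_bigr => j _; rewrite !mxE.
Qed.

Lemma std_form_roots i j :
  std_form m (simple_root R i) (simple_root R j) = cartan R m i j.
Proof.
rewrite std_form_root (bigD1 j) //= big1 ?addr0 => [|l lj];
  rewrite [simple_root _ _ _ _]mxE !eqxx; first by rewrite mulr1.
by rewrite (negPf lj) mulr0.
Qed.

Lemma cartan_diag i : cartan R m i i = 2.
Proof. by rewrite mxE eqxx. Qed.

Lemma cartan_int i j : cartan R m i j \is a Num.int.
Proof. by rewrite mxE; do ?case: ifP => _;
  rewrite ?rpredN ?rpred1 ?rpred_nat. Qed.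

End StandardForm.

(** ** Words in the generators *)

Section Words.
Variables (k : nat) (G : groupType) (s : 'I_k -> G).
Implicit Types (x : G) (u : seq 'I_k).

(** The head of the list is the last letter of the word, so that prolonging a
word on the right is [cons]. *)
Definition wprod u : G := foldr (fun i x => (x * s i)%g) 1%g u.

Definition expressible x : Prop := exists u, wprod u = x.

(** The value on elements that are not words is a dummy. *)
Definition wlength x : nat :=
  if pselect (exists n, `[< exists2 u, size u = n & wprod u = x >]) is left ex
  then ex_minn ex else 0%N.

Lemma wlength_min u : (wlength (wprod u) <= size u)%N.
Proof.
rewrite /wlength; case: pselect => // ex; case: ex_minnP => n _; apply.
by apply/asboolP; exists u.
Qed.

Lemma wlength_reduced x : expressible x ->
  exists2 u, size u = wlength x & wprod u = x.
Proof.
move=> [u ux]; rewrite /wlength; case: pselect => [ex|[]]; last first.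
  by exists (size u); apply/asboolP; exists u.
by case: ex_minnP => n /asboolP.
Qed.

Lemma expressibleM x i : expressible x -> expressible (x * s i)%g.
Proof. by case=> u <-; exists (i :: u). Qed.

Lemma wlengthM x i : expressible x -> (wlength (x * s i)%g <= (wlength x).+1)%N.
Proof. by case/wlength_reduced=> u <- <-; exact: (wlength_min (i :: u)). Qed.

End Words.

(** ** The theorem of Tits *)

(** Stated for any group G whose generators satisfy the Coxeter relations, so
that [coxeter_group_exists] can apply it to a product of groups and obtain the
universal property. *)
Section Tits.
Variables (R : realType) (k : nat) (m : 'I_k -> 'I_k -> nat).
Variables (G : groupType) (s : 'I_k -> G).
Variable rho : {multiplicative G -> GL 'rV[R]_k}.
Hypothesis m_cox : coxeter_matrix m.
Hypothesis m_simple : simple_bonds m.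
Hypothesis s_rel : forall i j, ((s i * s j) ^+ m i j)%g = 1%g.
Hypothesis rhoP : standard_rep m s rho.

Local Notation act x v := (gl_fun (rho x) v).
Local Notation root i := (simple_root R i).
Local Notation len := (wlength s).

Let m_sym i j : m i j = m j i. Proof. by case: m_cox. Qed.

Lemma cox_invol i : (s i * s i = 1)%g.
Proof. by have := s_rel i i; case: m_cox => -> _ _; rewrite expg1. Qed.

Lemma cox_cancel x i : (x * s i * s i = x)%g.
Proof. by rewrite -mulgA cox_invol mulg1. Qed.

Lemma cox_comm i j : i != j -> ~~ diagram m i j -> (s i * s j = s j * s i)%g.
Proof.
move=> ij; rewrite /diagram ij /= negbK => /eqP mij.
have := s_rel i j; rewrite mij expgS expg1 => e.
have {e} : (s i * s j * (s i * s j) * s j * s i = s j * s i)%g by rewrite e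
  mul1g.
by rewrite !mulgA !cox_cancel.
Qed.

Lemma cox_braid i j : diagram m i j -> (s i * s j * s i = s j * s i * s j)%g.
Proof.
move=> ij; have := s_rel i j; rewrite (m_simple ij) !expgS expg0 mulg1 => e.
have {e} : (s i * s j * (s i * s j * (s i * s j)) * s j * s i * s j
          = s j * s i * s j)%g by rewrite e mul1g.
by rewrite !mulgA !cox_cancel.
Qed.

Lemma actM x y v : act (x * y)%g v = act x (act y v).
Proof. exact: sd_actM. Qed.

Lemma actD x u v : act x (u + v) = act x u + act x v.
Proof. by rewrite /gl_fun linearD. Qed.

Lemma actN x u : act x (- u) = - act x u.
Proof. by rewrite /gl_fun linearN. Qed.

Lemma act_simple i j : act (s i) (root j) = root j - cartan R m i j *: root i.
Proof. by rewrite rhoP std_form_roots. Qed.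

Lemma act_simple_self i : act (s i) (root i) = - root i.
Proof. by rewrite act_simple cartan_diag scaler_nat mulr2n opprD addNKr. Qed.

Lemma act_comm i j : i != j -> ~~ diagram m i j -> act (s i) (root j) = root j.
Proof.
move=> ij nd; rewrite act_simple mxE (negPf ij) (negPf nd).
by rewrite scale0r subr0.
Qed.

Lemma act_bond i j : diagram m i j -> act (s i) (root j) = root j + root i.
Proof.
move=> d; rewrite act_simple mxE d; have /andP[/negPf-> _] := d.
by rewrite scaleN1r opprK.
Qed.

Definition nonneg_row (v : 'rV[R]_k) : Prop := forall j, 0 <= v 0 j.

Lemma nonneg_rowD u v : nonneg_row u -> nonneg_row v -> nonneg_row (u + v).
Proof. by move=> u0 v0 j; rewrite mxE addr_ge0. Qed.

(** By induction on the length of x = y s_t: in the rank two group of s_t and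
s_i, of type A1 x A1 or A2, the image of the root under x is a sum of images of
simple roots under shorter elements that satisfy the same condition on lengths.
*)
Lemma root_nonneg x i : expressible s x -> (len x <= len (x * s i)%g)%N ->
  nonneg_row (act x (root i)).
Proof.
have [n] := ubnP (len x); elim: n x i => // n IHn x i lt_n ex le_xi.
have [[|t u] su ux] := wlength_reduced ex.
  by rewrite -ux /= sd_act1 => j; rewrite mxE; case: (_ && _).
pose y := wprod s u; have ey : expressible s y by exists u.
have yx : (y * s t)%g = x by [].
have len_y : (len x = (len y).+1)%N.
  apply/eqP; rewrite eqn_leq -{1}yx wlengthM //= -su /= ltnS.
  exact: wlength_min.
have ti : t != i.
  apply: contraTneq le_xi => <-; rewrite -yx cox_cancel -ltnNge.
  by rewrite yx len_y.
have [d|nd] := boolP (diagram m t i); last first.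
  rewrite -yx actM (act_comm ti nd); apply: IHn => //; first by lia.
  rewrite leqNgt; apply/negP => lt_y.
  have := wlengthM t (expressibleM i ey).
  have -> : (y * s i * s t = x * s i)%g by rewrite -yx -!mulgA (cox_comm ti nd).
  lia.
have [le_yi|lt_yi] := leqP (len y) (len (y * s i)%g).
  rewrite -yx actM (act_bond d) actD; apply: nonneg_rowD.
    by apply: IHn => //; lia.
  by apply: IHn => //; [lia | rewrite yx len_y].
have [z [zE ez zy]] : exists z,
    [/\ z = (y * s i)%g, expressible s z & (z * s i)%g = y].
  exists (y * s i)%g; split; rewrite ?cox_cancel //; exact: expressibleM.
have len_z : (len y = (len z).+1)%N.
  by apply/eqP; rewrite eqn_leq -{1}zy wlengthM // zE.
have -> : act x (root i) = act z (root t).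
  rewrite -yx -zy !actM (act_bond d) actD act_simple_self act_bond.
    by rewrite addrC addrK.
  by rewrite /diagram eq_sym m_sym.
apply: IHn => //; first lia.
rewrite leqNgt; apply/negP => lt_zt.
have := wlengthM i (expressibleM t ez).
have := wlengthM t (expressibleM i (expressibleM t ez)).
have -> : (z * s t * s i * s t = x * s i)%g.
  by rewrite -yx -zy -!mulgA; congr (_ * _)%g; rewrite !mulgA cox_braid.
lia.
Qed.

Lemma root_signs x i : expressible s x ->
  nonneg_row (act x (root i)) \/ nonneg_row (- act x (root i)).
Proof.
move=> ex; have [le|lt] := leqP (len x) (len (x * s i)%g).
  by left; exact: root_nonneg.
right; have := @root_nonneg (x * s i)%g i (expressibleM i ex).
rewrite cox_cancel => /(_ (ltnW lt)).
by rewrite actM act_simple_self actN.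
Qed.

(** If s_t is the last letter of a reduced word of x, then x sends the t-th
simple root to a nonpositive vector, which is not the root itself. *)
Lemma tits_faithful x : expressible s x -> rho x = 1%g -> x = 1%g.
Proof.
move=> ex rx; have [[|t u] su ux] := wlength_reduced ex; first by rewrite -ux.
have yx : (wprod s u * s t)%g = x by [].
have ey : expressible s (wprod s u) by exists u.
have /(_ t) : nonneg_row (act (wprod s u) (root t)).
  apply: root_nonneg => //; rewrite yx -su /= ltnW // ltnS.
  exact: wlength_min.
have : act x (root t) = root t by rewrite rx /gl_fun id_lfunE.
rewrite -yx actM act_simple_self actN => /(canRL opprK) ->.
by rewrite !mxE !eqxx oppr_ge0 ler10.
Qed.

Lemma root_coord_int x i j :
  expressible s x -> act x (root i) 0 j \is a Num.int.
Proof.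
case=> u <-; elim: u i j => [|l u IHu] i j /=.
  by rewrite sd_act1 mxE; case: (_ && _); rewrite ?rpred0 ?rpred1.
rewrite actM act_simple /gl_fun linearB linearZ /=.
have := cartan_int R m l i; move: (cartan R m l i) => c c_int.
by rewrite !mxE rpredB ?rpredM //; exact: IHu.
Qed.

Lemma act_form x u v : expressible s x ->
  std_form m (act x u) (act x v) = std_form m u v.
Proof.
have form_refl i a b :
    std_form m (a - std_form m (root i) a *: root i) (b - std_form m (root i)
      b *: root i)
    = std_form m a b.
  rewrite -!scaleNr ![_ + _ *: _]addrC std_formDl !std_formDr //.
  by rewrite std_form_roots cartan_diag (std_formC m_sym a (root i)); ring.
case=> w <-; elim: w u v => [|i w IHw] u v /=; first by rewrite !sd_act1.
by rewrite !actM IHw !rhoP form_refl.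
Qed.

Lemma generated_expressible x : generated (range s) x -> expressible s x.
Proof.
move=> gx; have inv u : expressible s (wprod s u)^-1%g.
  suff H v : expressible s (wprod s v * (wprod s u)^-1)%g.
    by rewrite -[X in expressible s X]mul1g; exact: (H [::]).
  elim: u v => [|i u IHu] v /=; first by rewrite invg1 mulg1; exists v.
  rewrite invgM mulgA (_ : (s i)^-1 = s i)%g; last first.
    by rewrite -[LHS]mulg1 -(cox_invol i) mulKg.
  exact: (IHu (i :: v)).
apply: (gx (expressible s)); split=> [|_ [i _ <-]]; last by exists [:: i];
  rewrite /= mul1g.
split=> [|y z [u <-] [v <-]]; first by exists [::].
have [w wE] := inv v.
have cat a b : wprod s (b ++ a) = (wprod s a * wprod s b)%g.
  by elim: b => [|i b IHb] /=; rewrite ?mulg1 // IHb mulgA.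
by exists (w ++ u); rewrite cat wE.
Qed.

End Tits.
(** * Generated subgroups, integral spans and reflections *)

Section Generated.
Variables (gT : groupType) (Q : set gT).

Lemma generated_sub x : Q x -> generated Q x.
Proof. by move=> Qx A [_]; apply. Qed.

Lemma generated1 : generated Q 1%g.
Proof. by move=> A [[]]. Qed.

Lemma generatedF x y : generated Q x -> generated Q y -> generated Q (x / y)%g.
Proof.
by move=> gx gy A AQ; have [[_ AF] _] := AQ; apply: AF; [exact: gx | exact: gy].
Qed.

Lemma generatedV x : generated Q x -> generated Q x^-1%g.
Proof. by move/(generatedF generated1); rewrite mul1g. Qed.

Lemma generatedM x y : generated Q x -> generated Q y -> generated Q (x * y)%g.
Proof. by move=> gx /generatedV /(generatedF gx); rewrite invgK. Qed.

End Generated.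

Section ZSpan.
Variables (R : realType) (V : vectType R) (A : set V).
Implicit Types u v : V.

Lemma Zspan_min (P : V -> Prop) :
  P 0 -> (forall u v, P u -> P v -> P (u - v)) ->
  (forall x, A x -> P x) -> forall v, Zspan A v -> P v.
Proof.
move=> P0 PB PA v [n [x [c [Ax ->]]]].
have PN u : P u -> P (- u) by move=> Pu; rewrite -[- u]add0r; apply: PB.
have PD u w : P u -> P w -> P (u + w).
  by move=> Pu Pw; rewrite -[w]opprK; apply: PB => //; apply: PN.
elim/big_ind: _ => // i _.
have Pn (j : nat) : P (x i *+ j).
  by elim: j => [|j IHj]; rewrite ?mulr0n // mulrS; apply: PD => //; apply: PA.
by case: (c i) => j; [exact: Pn | apply: PN; exact: Pn].
Qed.

Lemma Zspan_sub x : A x -> Zspan A x.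
Proof.
by move=> Ax; exists 1%N, (fun=> x), (fun=> 1); rewrite big_ord1.
Qed.

Lemma Zspan0 : Zspan A 0.
Proof.
by exists 0%N, (fun=> 0), (fun=> 0); rewrite big_ord0; split=> // -[].
Qed.

Lemma ZspanD u v : Zspan A u -> Zspan A v -> Zspan A (u + v).
Proof.
move=> [n [x [c [Ax ->]]]] [n' [x' [c' [Ax' ->]]]].
exists (n + n')%N,
  (fun i : 'I_(n + n') => match fintype.split i with inl j => x j | inr j =>
    x' j end),
  (fun i : 'I_(n + n') => match fintype.split i with inl j => c j | inr j =>
    c' j end).
split=> [i|]; first by case: fintype.split.
rewrite big_split_ord /=; congr (_ + _); apply: eq_bigr => i _.
  by case: split_ordP => j /eqP; rewrite ?eq_lshift ?eq_lrshift // => /eqP ->.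
by case: split_ordP => j /eqP; rewrite ?eq_rshift ?eq_rlshift // => /eqP ->.
Qed.

Lemma ZspanMz u (z : int) : Zspan A u -> Zspan A (u *~ z).
Proof.
move=> [n [x [c [Ax ->]]]]; exists n, x, (fun i => c i * z); split=> //.
by rewrite mulrz_suml; apply: eq_bigr => i _; rewrite mulrzA.
Qed.

Lemma ZspanN u : Zspan A u -> Zspan A (- u).
Proof. by move/(ZspanMz (-1)); rewrite mulrN1z. Qed.

Lemma ZspanB u v : Zspan A u -> Zspan A v -> Zspan A (u - v).
Proof. by move=> Au /ZspanN; apply: ZspanD. Qed.

Lemma Zspan_sum n (x : 'I_n -> V) (c : 'I_n -> int) : (forall i, A (x i)) ->
  Zspan A (\sum_i x i *~ c i).
Proof. by move=> Ax; exists n, x, c. Qed.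

End ZSpan.

Lemma Zspan_le (R : realType) (V : vectType R) (A C : set V) :
  A `<=` Zspan C -> Zspan A `<=` Zspan C.
Proof.
move=> AC; apply: Zspan_min => //; [exact: Zspan0 | exact: ZspanB].
Qed.

Section GLtheory.
Variables (K : fieldType) (V : vectType K).

Lemma GL_ext (g h : GL V) : (forall v, gl_fun g v = gl_fun h v) -> g = h.
Proof. by move=> gh; apply: val_inj; apply/lfunP. Qed.

Lemma GLM (g h : GL V) v : gl_fun (g * h)%g v = gl_fun g (gl_fun h v).
Proof. by rewrite /gl_fun comp_lfunE. Qed.

Lemma GL1 v : gl_fun (1%g : GL V) v = v.
Proof. by rewrite /gl_fun id_lfunE. Qed.

Lemma GL_exists (f f' : V -> V) : linear f -> cancel f f' ->
  exists g : GL V, forall v, gl_fun g v = f v.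
Proof.
move=> lf fK.
pose fL : {linear V -> V} := HB.pack f (GRing.isLinear.Build _ _ _ _ f lf).
have kf : lker (linfun fL) == 0%VS.
  by apply/lker0P => u v; rewrite !lfunE; apply: (can_inj fK).
by exists (GLElt kf) => v; rewrite /gl_fun lfunE.
Qed.

End GLtheory.

Section ReflectionRelations.
Variables (R : realType) (k : nat) (m : 'I_k -> 'I_k -> nat).
Variables (V : vectType R) (phi : 'I_k -> V -> R) (al : 'I_k -> V).
Hypothesis m_cox : coxeter_matrix m.
Hypothesis m_simple : simple_bonds m.
Hypothesis phi_lin : forall i c u v, phi i (c *: u + v) = c * phi i u + phi i v.
Hypothesis phi_al : forall i j, phi i (al j) = cartan R m i j.

Let phiB i c u v : phi i (u - c *: v) = phi i u - c * phi i v.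
Proof. by rewrite addrC -scaleNr phi_lin mulNr addrC. Qed.

Lemma reflection_GL : exists r : 'I_k -> GL V,
  forall i v, gl_fun (r i) v = v - phi i v *: al i.
Proof.
suff /boolp.choice[r rE] : forall i, exists g : GL V,
    forall v, gl_fun g v = v - phi i v *: al i by exists r.
move=> i; apply: (@GL_exists _ _ _ (fun v => v - phi i v *: al i)).
  move=> c u v; rewrite phi_lin scalerBr scalerDl scalerA opprD.
  by rewrite addrACA.
move=> v; rewrite phiB phi_al cartan_diag mulr_natr mulr2n opprD addrA subrr.
by rewrite add0r scaleNr opprK subrK.
Qed.

(** Where the Cartan entry is -1, both sides of the braid relation are the
reflection in al i + al j. *)
Lemma reflection_relations (r : 'I_k -> GL V) :
  (forall i v, gl_fun (r i) v = v - phi i v *: al i) ->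
  forall i j, ((r i * r j) ^+ m i j)%g = 1%g.
Proof.
move=> rE.
have invol i : (r i * r i = 1)%g.
  apply: GL_ext => v; rewrite GLM GL1 !rE phiB phi_al cartan_diag.
  by rewrite mulr_natr mulr2n opprD addrA subrr add0r scaleNr opprK subrK.
move=> i j; have [m1 msym _] := m_cox.
have [<-|ij] := eqVneq i j; first by rewrite m1 expg1.
have [d|nd] := boolP (diagram m i j); last first.
  have /eqP -> : m i j == 2%N by move: nd; rewrite /diagram ij negbK.
  suff e : (r i * r j = r j * r i)%g.
    by rewrite expgS expg1 {1}e mulgA -(mulgA (r j)) invol mulg1 invol.
  apply: GL_ext => v; rewrite !GLM !rE !phiB !phi_al.
  rewrite !mxE (eq_sym j) (negPf ij) (negPf nd) /diagram (eq_sym j) msym.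
  rewrite -/(diagram m i j) (negPf nd) !mulr0 !subr0.
  by rewrite addrAC.
rewrite (m_simple d).
have third i' j' : diagram m i' j' -> forall v,
    gl_fun (r i' * r j' * r i')%g v =
      v - (phi i' v + phi j' v) *: (al i' + al j').
  move=> d' v; have /andP[ij' _] := d'.
  have d'' : diagram m j' i' by rewrite /diagram eq_sym msym.
  rewrite !GLM !rE !phiB !phi_al !mxE !eqxx d' d'' (eq_sym j') (negPf ij').
  have -> : phi j' v - phi i' v * -1 = phi i' v + phi j' v by ring.
  have -> : phi i' v - phi i' v * 2 - (phi i' v + phi j' v) * -1 = phi j' v.
    by ring.
  by rewrite scalerDr [(_ + _) *: al i']scalerDl !opprD !addrA addrAC.
have e : (r i * r j * r i = r j * r i * r j)%g.
  apply: GL_ext => v; rewrite !third //; last by rewrite /diagram eq_sym msym.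
  by rewrite addrC [phi i v + _]addrC [al i + _]addrC addrC.
rewrite !expgS expg0 mulg1.
have -> : (r i * r j * (r i * r j * (r i * r j)))%g =
          (r i * r j * r i * (r j * r i * r j))%g by rewrite !mulgA.
rewrite -e !mulgA -(mulgA (r i * r j)%g) invol mulg1.
by rewrite -(mulgA (r i)) invol mulg1 invol.
Qed.

End ReflectionRelations.
(** * Roots of a simply laced Coxeter group *)

Section Roots.
Variables (R : realType) (E : ext_coxeter R).
Local Notation k := (ext_k E).
Local Notation m := (@ext_m R E).
Local Notation s := (@ext_s R E).
Local Notation rho := (@ext_rho R E).
Local Notation root i := (simple_root R i).
Local Notation act x v := (gl_fun (rho x) v).
Local Notation L := (cox_roots rho).
Local Notation q := (std_form m).

Lemma ext_m_cox : coxeter_matrix m. Proof. by case: (ext_presented E). Qed.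

Lemma ext_m_sym i j : m i j = m j i. Proof. by case: ext_m_cox. Qed.

Lemma ext_rel i j : ((s i * s j) ^+ m i j = 1)%g.
Proof. by case: (ext_presented E). Qed.

Lemma ext_expressible x : expressible s x.
Proof.
apply: (generated_expressible ext_m_cox ext_rel).
by case: (ext_presented E) => _ -> _ _.
Qed.

Lemma cox_root_simple i : L (root i).
Proof. by exists 1%g, i; rewrite sd_act1. Qed.

Lemma cox_root_int v i : L v -> v 0 i \is a Num.int.
Proof. by case=> x [j ->]; apply: (root_coord_int (@ext_rhoP R E));
  exact: ext_expressible. Qed.

Lemma cox_form_act x u v : q (act x u) (act x v) = q u v.
Proof.
exact: (act_form ext_m_cox (@ext_rhoP R E)) (ext_expressible x).
Qed.

Lemma cox_root_norm v : L v -> q v v = 2.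
Proof. by case=> x [i ->]; rewrite cox_form_act std_form_roots cartan_diag. Qed.

Lemma cox_root_refl u v : L u -> L v -> L (v - q u v *: u).
Proof.
case=> x [i ->] [y [j ->]]; exists (x * s i * x^-1 * y)%g, j.
have yE : act y (root j) = act x (act x^-1%g (act y (root j))).
  by rewrite -sd_actM mulgV sd_act1.
rewrite !sd_actM [in LHS]yE; move: (act x^-1%g _) => z.
have actBZ c z1 z2 : act x (z1 - c *: z2) = act x z1 - c *: act x z2.
  by rewrite /gl_fun linearB linearZ.
by rewrite cox_form_act ext_rhoP actBZ.
Qed.

Lemma row_simple_roots (u : 'rV[R]_k) : u = \sum_i u 0 i *: root i.
Proof. exact: row_sum_delta. Qed.

Lemma cox_root_form_int u v : L u -> L v -> q u v \is a Num.int.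
Proof.
move=> Lu Lv; rewrite std_formE; apply: rpred_sum => i _;
  apply: rpred_sum => j _.
by rewrite !rpredM ?cartan_int ?cox_root_int.
Qed.

Lemma cox_lattice_int v : Zspan L v -> forall i, v 0 i \is a Num.int.
Proof.
move: v; apply: (Zspan_min (P := fun v : 'rV[R]_k =>
  forall i, v 0 i \is a Num.int)) => [i|u v uI vI i|v Lv i].
- by rewrite mxE rpred0.
- by rewrite !mxE rpredB.
- exact: cox_root_int.
Qed.

Lemma cox_root_signs v : L v -> exists c : 'I_k -> nat,
  v = \sum_i root i *+ c i \/ v = - \sum_i root i *+ c i.
Proof.
have nonneg (u : 'rV[R]_k) : (forall i, u 0 i \is a Num.int) -> nonneg_row u ->
    exists c : 'I_k -> nat, u = \sum_i root i *+ c i.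
  move=> u_int u_ge0.
  have /boolp.choice[c cE] : forall i, exists c : nat, u 0 i = c%:R.
    by move=> i; apply/natrP; rewrite natrEint u_int u_ge0.
  exists c; rewrite {1}[u]row_simple_roots; apply: eq_bigr => i _.
  by rewrite cE scaler_nat.
move=> Lv; have [x [i vE]] := Lv.
have [v_ge0|v_le0] := root_signs ext_m_cox (@ext_simple R E) ext_rel
  (@ext_rhoP R E) i (ext_expressible x).
  have [|c cE] := nonneg v (fun i => cox_root_int i Lv); first by rewrite vE.
  by exists c; left.
have [||c cE] := nonneg (- v).
- by move=> j; rewrite mxE rpredN cox_root_int.
- by rewrite vE.
by exists c; right; rewrite -cE opprK.
Qed.

End Roots.
(** * The extended Coxeter group as a group generated by reflections *)

Lemma isomorphic_sym (X Y : gen_system) :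
  is_subgroup (@gs_group X) -> @gs_gens X `<=` @gs_group X ->
  @gs_gens Y `<=` @gs_group Y -> isomorphic X Y -> isomorphic Y X.
Proof.
move=> [X1 XF] sX sY [f [[fXY finj fsurj] fM [gXY ginj gsurj]]].
have XM x y : gs_group x -> gs_group y -> @gs_group X (x * y)%g.
  move=> Xx Xy; have := XF _ _ X1 Xy; rewrite div1g => Xy'.
  by have := XF _ _ Xx Xy'; rewrite invgK.
have /boolp.choice[h hP] : forall y : gs_type Y, exists x : gs_type X,
    gs_group y -> gs_group x /\ f x = y.
  move=> y; have [Yy|nYy] := pselect (gs_group y); last by exists 1%g.
  by have [x Xx <-] := fsurj y Yy; exists x.
have inj x y : gs_group x -> gs_group y -> f x = f y -> x = y.
  by move=> Xx Xy; apply: finj; rewrite inE.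
have hf x : gs_group x -> h (f x) = x.
  by move=> Xx; have [? ?] := hP (f x) (fXY x Xx); apply: inj.
exists h; split.
- split=> [y Yy|y z|x Xx]; first by have [] := hP y Yy.
    rewrite !inE => Yy Yz e; have [_ <-] := hP y Yy; have [_ <-] := hP z Yz.
    by rewrite e.
  by exists (f x); [exact: fXY | exact: hf].
- move=> y z Yy Yz; have [Xy fy] := hP y Yy; have [Xz fz] := hP z Yz.
  by rewrite -{1}fy -{1}fz -fM // hf //; exact: XM.
split=> [y Yy|y z|x Xx].
- by have [x Xx <-] := gsurj y Yy; rewrite /= hf //; exact: sX.
- rewrite !inE => /sY Yy /sY Yz e; have [_ <-] := hP y Yy.
  by have [_ <-] := hP z Yz; rewrite e.
by exists (f x); [exact: gXY | apply: hf; exact: sX].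
Qed.

(** The reflections of V in the vectors al i, whose Gram matrix is the Cartan
matrix, together with the reflection in al t + a for a radical vector a. *)
Section Core.
Variables (R : realType) (E : ext_coxeter R) (V : vectType R).
Variables (B : V -> V -> R) (al : 'I_(ext_k E) -> V) (a : V).
Hypothesis B_lin : forall w c u v, B w (c *: u + v) = c * B w u + B w v.
Hypothesis B_sym : forall u v, B u v = B v u.
Hypothesis B_al : forall i j, B (al i) (al j) = cartan R (@ext_m R E) i j.
Hypothesis B_a : forall v, B a v = 0.
Hypothesis a_neq0 : a != 0.

Local Notation k := (ext_k E).
Local Notation m := (@ext_m R E).
Local Notation s := (@ext_s R E).
Local Notation rho := (@ext_rho R E).
Local Notation t := (ext_t E).
Local Notation root i := (simple_root R i).
Local Notation act x v := (gl_fun (rho x) v).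

Definition comb (u : 'rV[R]_k) : V := \sum_i u 0 i *: al i.

Hypothesis al_indep : forall (u : 'rV[R]_k) c, comb u = c *: a -> u = 0.
(* Only integral vectors are required not to be radical, since the translation
   part of an extended Coxeter group lies in the root lattice. *)
Hypothesis al_nondeg : forall u : 'rV[R]_k, (forall i, u 0 i \is a Num.int) ->
  (forall v, B (comb u) v = 0) -> u = 0.

Definition refl_gens : set (GL V) := [set g |
  (exists i, forall v, gl_fun g v = v - B (al i) v *: al i) \/
  forall v, gl_fun g v = v - B (al t + a) v *: (al t + a)].

Lemma combP c u v : comb (c *: u + v) = c *: comb u + comb v.
Proof.
rewrite /comb scaler_sumr -big_split; apply: eq_bigr => i _ /=.
by rewrite !mxE scalerDl scalerA.
Qed.

Lemma comb0 : comb 0 = 0.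
Proof. by rewrite /comb big1 // => i _; rewrite mxE scale0r. Qed.

Lemma combD u v : comb (u + v) = comb u + comb v.
Proof. by have := combP 1 u v; rewrite !scale1r. Qed.

Lemma combB c u v : comb (u - c *: v) = comb u - c *: comb v.
Proof. by rewrite addrC -scaleNr combP scaleNr addrC. Qed.

Lemma comb_root i : comb (root i) = al i.
Proof.
rewrite /comb (bigD1 i) //= big1 ?addr0 => [|j ji]; rewrite mxE !eqxx.
  by rewrite scale1r.
by rewrite (negPf ji) scale0r.
Qed.

Lemma B0 u : B u 0 = 0.
Proof. by have := B_lin u 1 0 0; rewrite scaler0 addr0; lra. Qed.

Lemma BZ u c v : B u (c *: v) = c * B u v.
Proof. by have := B_lin u c v 0; rewrite !addr0 B0 addr0. Qed.

Lemma BD w u v : B w (u + v) = B w u + B w v.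
Proof. by have := B_lin w 1 u v; rewrite scale1r mul1r. Qed.

Lemma BB w c u v : B w (u - c *: v) = B w u - c * B w v.
Proof. by rewrite BD -scaleNr BZ mulNr. Qed.

Lemma B_comb i u : B (al i) (comb u) = std_form m (root i) u.
Proof.
rewrite std_form_root /comb; elim/big_rec2: _ => [|j y v _ <-]; first exact: B0.
by rewrite BD BZ B_al mulrC.
Qed.

(** With T_l v = v - B l v a for l in the span of the al i, the map (w, l) |->
w T_l is a homomorphism, because w T_l w^-1 = T_(w l), and it sends (s_t, al_t)
to the reflection in al_t + a. Its image is generated by the reflections:
T_(al_t) is a product of two of them, and in a connected simply laced diagram
all roots are conjugate to al_t. It is injective: if w T_l = 1 then w acts
trivially on the span of the al i, so w = 1 by Tits, and then l is an integral
radical vector. *)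
Lemma core_isomorphism :
  let X := GenSystem (generated refl_gens) refl_gens in
  isomorphic (ext_system E) X /\ isomorphic X (ext_system E).
Proof.
have phi_lin i c u v : B (al i) (c *: u + v) = c * B (al i) u + B (al i) v.
  exact: B_lin.
have [r rE] := reflection_GL (phi := fun i v => B (al i) v) phi_lin B_al.
have [psi psiE] : exists psi : {multiplicative ext_W E -> GL V},
    forall i, psi (s i) = r i.
  have [_ _ _ univ] := ext_presented E; apply: univ.
  exact: (reflection_relations (@ext_m_cox R E) (@ext_simple R E) phi_lin B_al
    rE).
have psi1 : psi 1%g = 1%g.
  by apply: (mulgI (psi 1%g)); rewrite -gmulfM !mulg1.
have /boolp.choice[T TE] : forall l : 'rV[R]_k, exists g : GL V,
    forall v, gl_fun g v = v - B (comb l) v *: a.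
  move=> l; apply: (@GL_exists _ _ _ (fun v => v + B (comb l) v *: a)).
    by move=> c u v; rewrite B_lin scalerBr scalerDl scalerA opprD addrACA.
  by move=> v; rewrite BB (B_sym _ a) B_a mulr0 subr0 subrK.
have TD l l' : T (l + l') = (T l * T l')%g.
  apply: GL_ext => v; rewrite GLM !TE BB (B_sym _ a) B_a mulr0 subr0.
  by rewrite combD B_sym BD scalerDl !(B_sym v) opprD addrA addrAC.
have T0 : T 0 = 1%g.
  by apply: GL_ext => v; rewrite TE GL1 comb0 B_sym B0 scale0r subr0.
have psi_ind (P : ext_W E -> Prop) : P 1%g ->
    (forall x i, P x -> P (x * s i)%g) -> forall x, P x.
  by move=> P1 PM x; have [u <-] := ext_expressible x; elim: u => //= i u;
    exact: PM.
have psiM x i : psi (x * s i)%g = (psi x * r i)%g by rewrite gmulfM psiE.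
have psi_a x : gl_fun (psi x) a = a.
  elim/psi_ind: x => [|x i IHx]; first by rewrite psi1 GL1.
  by rewrite psiM GLM rE (B_sym _ a) B_a scale0r subr0.
have psi_B x u v : B (gl_fun (psi x) u) (gl_fun (psi x) v) = B u v.
  elim/psi_ind: x u v => [|x i IHx] u v; first by rewrite psi1 !GL1.
  rewrite psiM !GLM IHx !rE BB ![B (_ - _) _]B_sym !BB B_al cartan_diag.
  by rewrite (B_sym v u) (B_sym v (al i)); ring.
have psi_comb x u : gl_fun (psi x) (comb u) = comb (act x u).
  elim/psi_ind: x u => [|x i IHx] u; first by rewrite psi1 GL1 sd_act1.
  rewrite psiM GLM sd_actM ext_rhoP -IHx rE; congr (gl_fun (psi x) _).
  by rewrite combB comb_root B_comb.
have conj x l : (psi x * T l = T (act x l) * psi x)%g.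
  apply: GL_ext => v; rewrite !GLM !TE -psi_comb psi_B.
  by rewrite {1}/gl_fun linearB linearZ /= -!/(gl_fun _ _) psi_a.
pose F (x : semidirect rho) : GL V := (psi x.1 * T x.2)%g.
have FM x y : F (x * y)%g = (F x * F y)%g.
  rewrite /F /= TD gmulfM -!mulgA; congr (_ * _)%g; rewrite !mulgA;
    congr (_ * _)%g.
  rewrite conj; congr (_ * _)%g; rewrite -sd_actM.
  by rewrite mulgV sd_act1.
have lat_act x l : Zspan (cox_roots rho) l -> Zspan (cox_roots rho) (act x l).
  move: l; apply: (Zspan_min (P := fun l => Zspan _ (act x l))).
  - by rewrite /gl_fun linear0; exact: Zspan0.
  - by move=> u v; rewrite /gl_fun linearB; exact: ZspanB.
  - by move=> _ [y [i ->]]; apply: Zspan_sub; exists (x * y)%g, i;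
    rewrite sd_actM.
have lat_root i : Zspan (cox_roots rho) (root i).
  exact/Zspan_sub/cox_root_simple.
have sgE : is_subgroup (@gs_group (ext_system E)).
  split=> [|x y Lx Ly]; first exact: Zspan0.
  rewrite /= /ext_group /=; apply: ZspanD; first exact: lat_act.
  by apply: ZspanN; exact: lat_act.
have Finj x : ext_group x -> F x = 1%g -> x = 1%g.
  case: x => x l Ll F1.
  have F1v v : gl_fun (psi x) (v - B (comb l) v *: a) = v.
    by rewrite -TE -GLM -[RHS]GL1 -F1.
  have x1 : x = 1%g.
    apply: (tits_faithful (@ext_m_cox R E) (@ext_simple R E) (@ext_rel R E)
      (@ext_rhoP R E) (ext_expressible x)).
    apply: GL_ext => u; rewrite GL1; apply/eqP; rewrite -subr_eq0; apply/eqP.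
    apply: (@al_indep _ (B (comb l) (comb u))).
    have := combB 1 (act x u) u; rewrite !scale1r => ->.
    have := F1v (comb u); rewrite /gl_fun linearB linearZ /= -!/(gl_fun _ _).
    by rewrite psi_comb psi_a => /(canRL (subrK _)) ->; rewrite addrC addKr.
  congr pair => //; apply: al_nondeg => [j|v]; first exact: cox_lattice_int.
  have := F1v v; rewrite x1 psi1 GL1 => /eqP;
    rewrite subr_eq addrC -subr_eq subrr eq_sym.
  by rewrite scaler_eq0 (negPf a_neq0) orbF => /eqP.
have gens_sub g : refl_gens g -> exists2 x, ext_gens x & F x = g.
  case=> [[i gE]|gE].
    exists (s i, 0); first by left; exists i.
    by rewrite /F /= T0 mulg1 psiE; apply: GL_ext => v; rewrite rE gE.
  exists (s t, root t); first by right.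
  rewrite /F /= psiE; apply: GL_ext => v; rewrite GLM rE TE gE comb_root.
  rewrite BB (B_sym _ a) B_a mulr0 subr0 [B (_ + _) _]B_sym BD !(B_sym v) B_a
    addr0.
  by rewrite scalerDr opprD addrA addrAC.
have sub_gens x : ext_gens x -> refl_gens (F x).
  case=> [[i ->]|->].
    left; exists i => v; by rewrite /F /= T0 mulg1 psiE rE.
  right=> v; rewrite /F /= psiE GLM rE TE comb_root.
  rewrite BB (B_sym _ a) B_a mulr0 subr0 [B (_ + _) _]B_sym BD !(B_sym v) B_a
    addr0.
  by rewrite scalerDr opprD addrA addrAC.
have gens_group : @ext_gens R E `<=` @ext_group R E.
  by move=> _ [[i ->]|->]; [exact: Zspan0 | exact: lat_root].
have F1 : F 1%g = 1%g by rewrite /F /= psi1 T0 mulg1.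
have FV x : F (x^-1)%g = (F x)^-1%g.
  by apply: (mulgI (F x)); rewrite -FM !mulgV F1.
have psi_gen x : generated refl_gens (psi x).
  elim/psi_ind: x => [|x i IHx]; first by rewrite psi1; exact: generated1.
  rewrite psiM; apply: generatedM => //; apply: generated_sub; left; exists i.
  exact: rE.
have T_gen l : Zspan (cox_roots rho) l -> generated refl_gens (T l).
  have T_root i : generated refl_gens (T (root i)).
    have T_act x l' : generated refl_gens (T l') ->
      generated refl_gens (T (act x l')).
      move=> Tl; have -> : T (act x l') = (psi x * T l' * (psi x)^-1)%g.
        by rewrite conj mulgK.
      by apply: generatedM; [apply: generatedM | apply: generatedV].
    have [[_ con _] _] := ext_star E.
    apply: (connect_ind (P := fun i =>
      generated refl_gens (T (root i))) con (i0 := t)).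
      have -> : T (root t) = ((r t)^-1 * F (s t, root t))%g.
        by rewrite /F /= psiE mulKg.
      apply: generatedM; first by rewrite -psiE; apply: generatedV;
        exact: psi_gen.
      by apply: generated_sub; apply: sub_gens; right.
    (* s_i' s_j sends the root of i' to the root of its neighbour j *)
    move=> i' j ij /(T_act (s i' * s j)%g).
    have ji : diagram m j i' by rewrite /diagram eq_sym ext_m_sym.
    rewrite sd_actM (act_bond (@ext_rhoP R E) ji) (actD rho).
    by rewrite (act_simple_self (@ext_rhoP R E)) (act_bond (@ext_rhoP R E) ij)
      addrC addrK.
  move: l; apply: (Zspan_min (P := fun l => generated refl_gens (T l))) =>
    [|u v|_ [x [i ->]]]; first by rewrite T0; exact: generated1.
    move=> gu gv; have -> : T (u - v) = (T u / T v)%g.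
      by rewrite -[X in (T X / _)%g](subrK v) [in RHS]TD mulgK.
    exact: generatedF.
  have -> : T (act x (root i)) = (psi x * T (root i) * (psi x)^-1)%g.
    by rewrite conj mulgK.
  by apply: generatedM; [apply: generatedM | apply: generatedV].
have Finj2 x y : ext_group x -> ext_group y -> F x = F y -> x = y.
  move=> Lx Ly e; apply/divg1_eq; apply: Finj; first by case: sgE => _; apply.
  by rewrite FM FV e mulgV.
suff iso : isomorphic (ext_system E) (GenSystem (generated refl_gens)
  refl_gens).
  split=> //; apply: isomorphic_sym iso => //= g; exact: generated_sub.
exists F; split=> [||].
- split=> [x Lx|x y|g /= gg]; rewrite ?inE.
  + by apply: generatedM; [exact: psi_gen | exact: T_gen].
  + exact: Finj2.
  + apply: (gg (F @` @ext_group R E)); split=> [|h /gens_sub[x gx <-]];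
    last first.
      by exists x => //; exact: gens_group.
    split=> [|_ _ [x Lx <-] [y Ly <-]].
      by exists 1%g => //; case: sgE.
    exists (x / y)%g; first by case: sgE => _; apply.
    by rewrite FM FV.
- by move=> x y _ _; exact: FM.
split=> [x|x y|g]; rewrite /= ?inE; first exact: sub_gens.
- by move=> /gens_group Lx /gens_group Ly; exact: Finj2.
- by move=> /gens_sub[x gx <-]; exists x.
Qed.
End Core.
(** * Tubular systems and their hyperbolic covers *)

Section SymmetricForms.
Variables (R : realType) (V : vectType R) (B : {symmetric V}).

Lemma symC u v : B u v = B v u.
Proof. by rewrite hermC expr0 mul1r. Qed.

Lemma symP w c u v : B w (c *: u + v) = c * B w u + B w v.
Proof. by rewrite linearPr. Qed.

Lemma symZ u c v : B u (c *: v) = c * B u v.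
Proof. by rewrite linearZr. Qed.

Lemma symD u v w : B u (v + w) = B u v + B u w.
Proof. by rewrite linearDr. Qed.

Lemma sym0 u : B u 0 = 0.
Proof. by rewrite linear0r. Qed.

Lemma symN u v : B u (- v) = - B u v.
Proof. by rewrite linearNr. Qed.

Lemma sym_sum I (r : seq I) (P : pred I) u (x : I -> V) :
  B u (\sum_(i <- r | P i) x i) = \sum_(i <- r | P i) B u (x i).
Proof. exact: (big_morph (B u) (symD u) (sym0 u)). Qed.

Lemma reflE al v : B al al = 2 -> refl B al v = v - B al v *: al.
Proof. by move=> e; rewrite /refl e [2 * _]mulrC mulfK // pnatr_eq0. Qed.

End SymmetricForms.

Lemma free_ordP (K : fieldType) (V : vectType K) n (x : 'I_n -> V) :
  free [seq x i | i : 'I_n] <->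
  forall c : 'I_n -> K, \sum_i c i *: x i = 0 -> forall i, c i = 0.
Proof.
have nthE (i : 'I_n) : [tuple x i | i < n]`_i = x i by rewrite -tnth_nth
  tnth_mktuple.
split=> [/(@freeP _ _ _ [tuple x i | i < n]) fr c c0|fr].
  by apply: fr; rewrite -[RHS]c0; apply: eq_bigr => i _; rewrite nthE.
apply/(@freeP _ _ _ [tuple x i | i < n]) => c c0; apply: fr.
by rewrite -[RHS]c0; apply: eq_bigr => i _; rewrite nthE.
Qed.

Section TubularFacts.
Variables (R : realType) (T : tubular R).
Local Notation B := (tub_form T).
Local Notation pi := (tub_pi T).
Local Notation Phi := (@tub_Phi R T).
Local Notation al := (@tub_alpha R T).
Local Notation be := (@tub_beta R T).
Local Notation mk := (@tub_m R T).

Let Phi_root : gen_root_system B fullv Phi.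
Proof. by have [] := tub_elliptic T. Qed.

Lemma tub_al_norm i : B (al i) (al i) = 2.
Proof. exact/tub_norm/tub_alpha_root. Qed.

Lemma tub_a_radical v : B (tub_a T) v = 0.
Proof.
have : Zspan Phi (tub_a T) /\ [set` tub_U T] (tub_a T).
  by have := Zspan_sub (erefl (tub_a T) : [set tub_a T] _); rewrite -tub_a_span.
by case=> _ /tub_U_rad; apply.
Qed.

(** The image of b spans the radical part of the affine root lattice. *)
Lemma tub_b_radical v : B (tub_b T) v = 0.
Proof.
have : Zspan (pi @` Phi) `&` (pi @` radical B) `<=` pi @` radical B.
  by move=> ? [].
rewrite -tub_m_span => /(_ _ (Zspan_sub (erefl _))) [r r_rad rE].
rewrite -tub_formQE; have -> : pi (tub_b T) = pi r; last first.
  by rewrite tub_formQE; exact: r_rad.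
rewrite rE /tub_b linear_sum; apply: eq_bigr => i _.
by rewrite linearMn /= tub_alphaE.
Qed.

Lemma tub_beta_free (c : 'I_(tub_n T).+1 -> R) :
  \sum_i c i *: be i = 0 -> forall i, c i = 0.
Proof. by have [/free_ordP fr _ _] := tub_beta_basis T; exact: fr. Qed.

Lemma tub_pi_sum (c : 'I_(tub_n T).+1 -> R) :
  pi (\sum_i c i *: al i) = \sum_i c i *: be i.
Proof.
by rewrite linear_sum; apply: eq_bigr => i _; rewrite linearZ /= tub_alphaE.
Qed.

(** The roots span, and every root is a combination of the alpha_i up to a
vector of U, which is radical. *)
Lemma tub_radicalP x : (forall i, B x (al i) = 0) -> forall v, B x v = 0.
Proof.
move=> x0.
have be0 i : tub_formQ T (pi x) (be i) = 0 by rewrite -tub_alphaE tub_formQE.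
have Phi0 g : Phi g -> B x g = 0.
  move=> Pg; rewrite -tub_formQE; have [_ _ signs] := tub_beta_basis T.
  have sum0 (n : 'I_(tub_n T).+1 -> nat) :
      tub_formQ T (pi x) (\sum_i be i *+ n i) = 0.
    by rewrite sym_sum big1 // => i _; rewrite -scaler_nat symZ be0 mulr0.
  have [|n [->|->]] := signs (pi g); first by exists g.
    exact: sum0.
  by rewrite symN sum0 oppr0.
move=> v; have : Rspan Phi v by rewrite (grs_span Phi_root) /= memvf.
case=> n [y [c [Py ->]]]; rewrite sym_sum big1 // => i _.
by rewrite symZ Phi0 ?mulr0.
Qed.

Lemma tub_kernel (c : 'I_(tub_n T).+1 -> int) :
  (forall j, \sum_i B (al j) (al i) * (c i)%:~R = 0) ->
  exists z : int, forall i, c i = z * (mk i)%:Z.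
Proof.
move=> c0; pose x := \sum_i (c i)%:~R *: al i.
have x_rad : radical B x.
  apply: tub_radicalP => j; rewrite symC sym_sum -[RHS](c0 j).
  by apply: eq_bigr => i _; rewrite symZ mulrC.
have : (Zspan (pi @` Phi) `&` (pi @` radical B)) (pi x).
  split; last by exists x.
  rewrite tub_pi_sum.
  have -> : \sum_i (c i)%:~R *: be i = \sum_i be i *~ c i.
    by apply: eq_bigr => i _; rewrite scaler_int.
  by apply: Zspan_sum => i; have [_ /(_ i)] := tub_beta_basis T.
rewrite -tub_m_span => -[n [y [z [yP]]]].
have -> : \sum_i y i *~ z i = (\sum_i be i *+ mk i) *~ \sum_i z i.
  by rewrite mulrz_sumr; apply: eq_bigr => i _; rewrite (yP i).
rewrite tub_pi_sum mulrz_suml => /eqP; rewrite -subr_eq0 -sumrB => /eqP e.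
exists (\sum_i z i) => i; apply/eqP; rewrite -(eqr_int R) -subr_eq0; apply/eqP.
move: i; apply: tub_beta_free; rewrite -[RHS]e; apply: eq_bigr => i _.
rewrite scalerBl; congr (_ - _).
by rewrite mulrC scaler_int mulrzA.
Qed.

Lemma tub_al_int i j : B (al i) (al j) \is a Num.int.
Proof.
have := grs_int Phi_root (tub_alpha_root i) (tub_alpha_root j).
by rewrite tub_al_norm [2 * _]mulrC mulfK // pnatr_eq0.
Qed.

(** If the product of two simple roots were positive, reflecting one in the
other would give a root with coefficients of both signs. *)
Lemma tub_al_off i j : i != j -> B (al i) (al j) <= 0.
Proof.
move=> ij; rewrite leNgt; apply/negP => gt0.
have := grs_refl Phi_root (tub_alpha_root j) (tub_alpha_root i).
rewrite reflE ?tub_al_norm // => Pr; have [_ _ signs] := tub_beta_basis T.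
have piE : pi (al i - B (al j) (al i) *: al j) = be i - B (al j) (al i) *: be j.
  by rewrite linearB linearZ /= !tub_alphaE.
pose d l : R := (l == i)%:R - B (al j) (al i) * (l == j)%:R.
have dE : \sum_l d l *: be l = be i - B (al j) (al i) *: be j.
  rewrite (bigD1 i) //= (bigD1 j) 1?eq_sym //= big1 => [|l /andP[li lj]].
    rewrite addr0 /d !eqxx (negPf ij) (eq_sym j) (negPf ij).
    by rewrite mulr0 subr0 scale1r sub0r mulr1 scaleNr.
  by rewrite /d (negPf li) (negPf lj) mulr0 subr0 scale0r.
have sumE (n : 'I_(tub_n T).+1 -> nat) :
    \sum_l be l *+ n l = \sum_l (n l)%:R *: be l.
  by apply: eq_bigr => l _; rewrite scaler_nat.
have [|n] := signs (be i - B (al j) (al i) *: be j).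
  by rewrite -piE; exists (al i - B (al j) (al i) *: al j).
rewrite -dE sumE => -[] /eqP;
  rewrite -subr_eq0 ?opprK -?sumrB -?big_split /= => /eqP e.
  have /(_ j) : forall l, d l - (n l)%:R = 0.
    apply: tub_beta_free; rewrite -[RHS]e; apply: eq_bigr => l _.
    by rewrite scalerBl.
  rewrite /d eqxx eq_sym (negPf ij) mulr1 sub0r symC => e'.
  have : 0 <= (n j)%:R :> R by [].
  lra.
have /(_ i) : forall l, d l + (n l)%:R = 0.
  apply: tub_beta_free; rewrite -[RHS]e; apply: eq_bigr => l _.
  by rewrite scalerDl.
rewrite /d eqxx (negPf ij) mulr0 subr0 /= => e'.
have : 0 <= (n i)%:R :> R by [].
lra.
Qed.

End TubularFacts.

(** The bijection sg matches the vertices of the diagram of E with the affine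
simple roots of T; it is the identity when E is built from T, and moves a vertex
of mark 1 to the affine node when T is built from E. *)
Section CoverIso.
Variables (R : realType) (T : tubular R) (H : hyperbolic_cover T).
Variables (E : ext_coxeter R).
Variables (sg : 'I_(ext_k E) -> 'I_(tub_n T).+1).
Variables (sg' : 'I_(tub_n T).+1 -> 'I_(ext_k E)).
Hypothesis sgK : cancel sg sg'.
Hypothesis sg'K : cancel sg' sg.
Hypothesis sg_form : forall i j,
  tub_form T (tub_alpha (sg i)) (tub_alpha (sg j)) = cartan R (@ext_m R E) i j.
Hypothesis sg_t : sg (ext_t E) = tub_t T.

Local Notation inc := (cov_inc H).
Local Notation Bh := (cov_form H).
Local Notation U := (subvs_of (cov_Vtilde H)).

Let incP x : inc x \in cov_Vtilde H.
Proof. by rewrite -[inc x]addr0 memv_add ?mem0v // memv_img ?memvf. Qed.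

Let inc_inj : injective inc.
Proof. by apply/lker0P/eqP; exact: cov_inc_inj. Qed.

(** An integral combination of the simple roots that is orthogonal to V is z b
for an integer z, and its product with b' is z; this is what b' is adjoined
for. *)
Lemma cover_isomorphism :
  isomorphic (ext_system E) (cover_system H) /\
  isomorphic (cover_system H) (ext_system E).
Proof.
pose toU x : U := vsproj (cov_Vtilde H) (inc x).
have toUE x : vsval (toU x) = inc x by rewrite vsprojK.
pose al i := toU (tub_alpha (sg i)); pose a := toU (tub_a T).
pose B (u v : U) := Bh (vsval u) (vsval v).
have inVt v : exists x c, vsval (v : U) = inc x + c *: cov_b' H.
  have /memv_addP[_ /memv_imgP[x _ ->] [_ /vlineP[c ->] ->]] := subvsP v.
  by exists x, c.
have Bab : Bh (inc (tub_a T)) (cov_b' H) = 0.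
  by have [_ _ _ _] := cov_sum H; apply; apply: memv_span;
    rewrite !inE eqxx ?orbT.
have comb_inc u : vsval (comb al u) = inc (\sum_j u 0 (sg' j) *: tub_alpha j).
  rewrite /comb !linear_sum (reindex sg') /=; last first.
    by exists sg => ? _; rewrite ?sgK ?sg'K.
  by apply: eq_bigr => j _; rewrite !linearZ /= toUE sg'K.
have iso := @core_isomorphism R E U B al a.
suff gensE : refl_gens B al a = @cover_gens R T H.
  rewrite /cover_system -gensE; apply: iso.
  - move=> w c u v; have e : vsval (c *: u + v) = c *: vsval u + vsval v.
      exact: linearP.
    by rewrite /B e symP.
  - by move=> u v; exact: symC.
  - by move=> i j; rewrite /B !toUE cov_inc_form.
  - move=> v; rewrite /B toUE; have [x [c ->]] := inVt v.
    by rewrite symD symZ cov_inc_form tub_a_radical Bab mulr0 addr0.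
  - apply/eqP => a0; have [_ _] := cov_pair_a H.
    rewrite -toUE -/a a0 linear0 symC sym0 => /esym/eqP.
    by rewrite oner_eq0.
  - move=> u c /(congr1 vsval); rewrite comb_inc linearZ /= toUE -linearZ.
    move=> /inc_inj /(congr1 (tub_pi T)); rewrite tub_pi_sum linearZ /=.
    have -> : tub_pi T (tub_a T) = 0.
      apply/eqP; rewrite -memv_ker tub_pi_ker.
      have : Zspan (@tub_Phi R T) (tub_a T) /\ [set` tub_U T] (tub_a T).
        by have := Zspan_sub (erefl (tub_a T) : [set tub_a T] _);
          rewrite -tub_a_span.
      by case.
    rewrite scaler0 => /tub_beta_free u0; apply/rowP => i.
    by rewrite mxE -(sgK i) u0.
  - move=> u u_int u0.
    have /boolp.choice[c cE] : forall j, exists c : int, u 0 (sg' j) = c%:~R.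
      by move=> j; apply/intrP; exact: u_int.
    have combE : vsval (comb al u) = inc (\sum_j (c j)%:~R *: tub_alpha j).
      by rewrite comb_inc; congr (inc _); apply: eq_bigr => j _; rewrite cE.
    have [j|z zE] := @tub_kernel R T c.
      have := u0 (toU (tub_alpha j)); rewrite /B combE toUE cov_inc_form symC.
      by rewrite sym_sum => e; rewrite -[RHS]e; apply: eq_bigr => i _;
        rewrite symZ mulrC.
    have b'P : cov_b' H \in cov_Vtilde H.
      by rewrite -[cov_b' H]add0r memv_add ?mem0v ?memv_line.
    have := u0 (vsproj _ (cov_b' H)); rewrite /B combE vsprojK //.
    have -> : \sum_j (c j)%:~R *: tub_alpha j = z%:~R *: tub_b T.
      rewrite /tub_b scaler_sumr; apply: eq_bigr => j _.
      by rewrite zE intrM -scalerA scaler_nat.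
    rewrite linearZ symC symZ symC /=; have [_ _ ->] := cov_pair_b H.
    rewrite mulr1 => z0; apply/rowP => i; rewrite mxE -(sgK i) cE zE intrM z0.
    by rewrite mul0r.
have norm2 x : tub_form T x x = 2 -> forall v : U,
    refl Bh (inc x) (vsval v) = vsval (v - B (toU x) v *: toU x).
  move=> x2 v; rewrite reflE ?cov_inc_form // linearB linearZ /= toUE.
  by rewrite /B toUE scalerN.
have norm_t : tub_form T (tub_alpha (tub_t T) + tub_a T)
                         (tub_alpha (tub_t T) + tub_a T) = 2.
  rewrite symD [X in X + _]symC symD tub_al_norm [X in _ + X]symC.
  by rewrite ![tub_form T _ (tub_a T)]symC !tub_a_radical !addr0.
have toUD : toU (tub_alpha (tub_t T) + tub_a T) = al (ext_t E) + a.
  by apply: subvs_inj; rewrite linearD /= !toUE sg_t linearD.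
apply/seteqP; split=> g.
- case=> [[i gE]|gE].
    by exists (Some (sg i)) => v; rewrite norm2 ?tub_al_norm // gE.
  by exists None => v; rewrite norm2 // toUD gE.
case=> -[j|] gE.
  left; exists (sg' j) => v; apply: subvs_inj; rewrite gE norm2 ?tub_al_norm //.
  by rewrite /al sg'K.
by right=> v; apply: subvs_inj; rewrite gE norm2 // toUD.
Qed.

End CoverIso.
(** * Existence of simply laced Coxeter groups *)

Section Subgroup.
Variables (gT : groupType) (H : set gT).
Hypothesis H_group : is_subgroup H.

(** The proof argument is a phantom from which the group structure is inferred.
*)
Definition subgroup_of & is_subgroup H := {x : gT | x \in H}.
Local Notation W := (subgroup_of H_group).

HB.instance Definition _ := SubChoice.on W.

Fact subgroup_closed : group_closed (fun x : gT => x \in H).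
Proof.
have [H1 HF] := H_group; split=> [|x y]; rewrite /in_mem /=.
  by rewrite inE.
by rewrite !inE; exact: HF.
Qed.

HB.instance Definition _ :=
  SubChoice_isSubGroup.Build gT (fun x : gT => x \in H) W subgroup_closed.

End Subgroup.

Lemma wprod_morph (k : nat) (G K : groupType) (h : {multiplicative G -> K})
  (s : 'I_k -> G) u : h (wprod s u) = wprod (fun i => h (s i)) u.
Proof.
elim: u => /= [|i u IHu]; last by rewrite gmulfM IHu.
by apply: (mulgI (h 1%g)); rewrite -gmulfM !mulg1.
Qed.

Lemma wprod_cat (k : nat) (G : groupType) (s : 'I_k -> G) u v :
  wprod s (v ++ u) = (wprod s u * wprod s v)%g.
Proof. by elim: v => [|i v IHv] /=; rewrite ?mulg1 // IHv mulgA. Qed.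

Section CoxeterGroup.
Variables (R : realType) (k : nat) (m : 'I_k -> 'I_k -> nat).
Hypothesis m_cox : coxeter_matrix m.
Hypothesis m_simple : simple_bonds m.

Let m_sym i j : m i j = m j i. Proof. by case: m_cox. Qed.

(** The reflection group W in the standard representation has the Coxeter
presentation.  Given f i in G satisfying the relations, so do the pairs
g i = (f i, r i) in G x GL, and Tits applies to g and the second projection: a
word in the g i with trivial second component has trivial first component.
Hence the value of a word in the f i depends only on its value in W. *)
Lemma coxeter_group_exists :
  exists (W : groupType) (s : 'I_k -> W)
    (rho : {multiplicative W -> GL 'rV[R]_k}),
    coxeter_system m s /\ standard_rep m s rho.
Proof.
pose phi i (v : 'rV[R]_k) := std_form m (simple_root R i) v.
have phi_lin i c u v : phi i (c *: u + v) = c * phi i u + phi i v.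
  exact: std_formDr.
have phi_al i j : phi i (simple_root R j) = cartan R m i j.
  exact: std_form_roots.
have [r rE] := reflection_GL phi_lin phi_al.
have r_rel := reflection_relations m_cox m_simple phi_lin phi_al rE.
have r_group : is_subgroup (generated (range r)).
  by split; [exact: generated1 | exact: generatedF].
pose W : groupType := subgroup_of r_group.
have r_gen i : r i \in generated (range r).
  by rewrite inE; apply: generated_sub; exists i.
pose s i : W := exist _ (r i) (r_gen i).
pose rho : {multiplicative W -> GL 'rV[R]_k} := val.
have rho_s i : rho (s i) = r i by [].
exists W, s, rho; split; last by move=> i v; rewrite rho_s rE.
have rho_inj : injective rho := val_inj.
have s_gen x : generated (range s) x.
  have img : is_subgroup (rho @` generated (range s)).
    split=> [|_ _ [y gy <-] [z gz <-]].
      by exists 1%g; [exact: generated1 | exact: gmulf1].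
    by exists (y / z)%g; [exact: generatedF | exact: gmulfF].
  have r_img : range r `<=` rho @` generated (range s).
    by move=> _ [i _ <-]; exists (s i) => //; apply: generated_sub; exists i.
  have : generated (range r) (rho x) by have := valP x; rewrite /in_mem /= inE.
  by case/(_ _ (conj img r_img)) => y gy /rho_inj <-.
have s_rel i j : ((s i * s j) ^+ m i j)%g = 1%g.
  by apply: rho_inj; rewrite gmulfXn gmulfM !rho_s r_rel gmulf1.
split=> //; first by apply/seteqP; split=> x _ //; exact: s_gen.
move=> G f f_rel.
pose g i : G * GL 'rV[R]_k := (f i, r i).
pose p1 : {multiplicative (G * GL 'rV[R]_k)%type -> G} := fst.
pose p2 : {multiplicative (G * GL 'rV[R]_k)%type -> GL 'rV[R]_k} := snd.
have g_rel i j : ((g i * g j) ^+ m i j)%g = 1%g.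
  rewrite [LHS]surjective_pairing; congr pair.
    by rewrite -/(p1 _) gmulfXn gmulfM f_rel.
  by rewrite -/(p2 _) gmulfXn gmulfM r_rel.
have p2_rep : standard_rep m g p2 by move=> i v; rewrite rE.
have same_value u v : wprod s u = wprod s v -> wprod f u = wprod f v.
  move=> uv; pose x := (wprod g u / wprod g v)%g.
  have x1 : x = 1%g.
    apply: (tits_faithful m_cox m_simple g_rel p2_rep); last first.
      have e : wprod (fun i => p2 (g i)) u = wprod (fun i => p2 (g i)) v.
        by rewrite -[LHS](wprod_morph rho s) -[RHS](wprod_morph rho s) uv.
      by rewrite /x gmulfF !(wprod_morph p2) e mulgV.
    apply: (generated_expressible m_cox g_rel); apply: generatedF.
      elim: u {uv x} => /= [|i u IHu]; first exact: generated1.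
      by apply: generatedM => //; apply: generated_sub; exists i.
    elim: v {uv x} => /= [|i v IHv]; first exact: generated1.
    by apply: generatedM => //; apply: generated_sub; exists i.
  apply/divg1_eq; have := congr1 p1 x1.
  by rewrite /x gmulfF !(wprod_morph p1) gmulf1.
have /boolp.choice[w wE] : forall x : W, exists u, wprod s u = x.
  by move=> x; apply: (generated_expressible m_cox s_rel); exact: s_gen.
have phiM : {morph (fun x => wprod f (w x)) : x y / (x * y)%g}.
  by move=> x y; rewrite -wprod_cat; apply: same_value; rewrite wprod_cat !wE.
pose phi' : {multiplicative W -> G} := HB.pack (fun x => wprod f (w x))
  (isMultiplicative.Build W G (fun x => wprod f (w x)) phiM).
exists phi' => i /=.
by rewrite (same_value _ [:: i]) /= ?mul1g // wE mul1g.
Qed.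
End CoxeterGroup.
(** * Every hyperbolic cover is an extended Coxeter system *)

Lemma cover_is_extended (R : realType) (T : tubular R)
    (H : hyperbolic_cover T) :
  exists E : ext_coxeter R, isomorphic (cover_system H) (ext_system E).
Proof.
have /boolp.choice[a0 a0E] : forall ij : 'I_(tub_n T).+1 * 'I_(tub_n T).+1,
    exists c : int, tub_form T (tub_alpha ij.1) (tub_alpha ij.2) = c%:~R.
  by move=> ij; apply/intrP; exact: tub_al_int.
pose a i j := a0 (i, j).
have aE i j : tub_form T (tub_alpha i) (tub_alpha j) = (a i j)%:~R.
  exact: (a0E (i, j)).
have a_diag i : a i i = 2.
  by apply/eqP; rewrite -(eqr_int R) -aE tub_al_norm.
have a_sym i j : a i j = a j i.
  by apply/eqP; rewrite -(eqr_int R) -!aE symC.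
have a_off i j : i != j -> a i j <= 0.
  by move/tub_al_off; rewrite aE -[0]/(0%:~R) ler_int.
have m_gt0 := @tub_m_pos R T.
have m_ker i : \sum_j a i j * (tub_m j)%:Z = 0.
  apply/eqP; rewrite -(eqr_int R) rmorph_sum /=.
  have := @tub_b_radical R T (tub_alpha i); rewrite symC /tub_b sym_sum => e.
  rewrite -[X in _ == X]e; apply/eqP; apply: eq_bigr => j _.
  by rewrite -scaler_nat symZ aE intrM mulrC.
have ker_m (f : 'I_(tub_n T).+1 -> int) : (forall i, \sum_j a i j * f j = 0) ->
    exists c : int, forall i, f i = c * (tub_m i)%:Z.
  move=> f0; apply: tub_kernel => i; have /(congr1 (intr : int -> R)) := f0 i.
  rewrite rmorph_sum /= => e; rewrite -[RHS]e; apply: eq_bigr => j _.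
  by rewrite aE intrM.
have m_max := @tub_t_max R T; have m_uniq := @tub_t_uniq R T.
have a_bond := bond_eqN1 a_diag a_sym a_off m_gt0 m_ker ker_m m_max m_uniq.
have star := bond_star a_diag a_sym a_off m_gt0 m_ker ker_m m_max m_uniq.
have deg := degree_max a_diag a_sym a_off m_gt0 m_ker ker_m m_max m_uniq.
pose m i j : nat := if i == j then 1 else if a i j == 0 then 2 else 3.
have diagE : diagram m = bond a.
  apply/funext => i; apply/funext => j; rewrite /diagram /bond /m.
  by case: (i == j) => //=; case: (a i j == 0).
have m_cox : coxeter_matrix m.
  split=> [i|i j|i j ij]; rewrite /m ?eqxx //; first by rewrite eq_sym a_sym.
  by rewrite (negPf ij); case: (a i j == 0).
have m_simple : simple_bonds m.
  by move=> i j; rewrite diagE /bond /m => /andP[/negPf-> /negPf->].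
have [W [s [rho [pres rhoP]]]] := @coxeter_group_exists R _ m m_cox m_simple.
rewrite -diagE in star deg.
pose E := ExtCoxeter pres m_simple star rhoP deg.
exists E.
have [] // := @cover_isomorphism R T H E id id.
move=> i j; rewrite aE mxE diagE; have [->|ij] := eqVneq i j;
  first by rewrite a_diag.
case: ifP => [/a_bond -> //|]; rewrite /bond ij /= => /negbFE/eqP -> //.
Qed.
(** * Positive integral marks of an affine diagram *)

(** The matrix is diagonalised by a unitary matrix over the complex numbers, and
its eigenvalues are the roots of the characteristic polynomial. *)
Lemma psd_of_spectrum (R : rcfType) n (A : 'M[R]_n) (r : seq R) :
  A^T = A -> char_poly A = \prod_(x <- r) ('X - x%:P) ->
  (forall x, x \in r -> 0 <= x) ->
  forall u : 'rV[R]_n, 0 <= (u *m A *m u^T) 0 0.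
Proof.
move=> A_sym A_char r_ge0 u.
pose C : numClosedFieldType := R[i]%C.
pose iota : {rmorphism R -> C} := real_complex R.
have iota_ge0 (x : R) : (0 <= iota x) = (0 <= x) by rewrite -(lecR 0 x).
have iota_real (x : R) : iota x \is Num.real.
  have [x0|/ltW x0] := leP 0 x; first by rewrite ger0_real ?iota_ge0.
  by rewrite -rpredN -rmorphN ger0_real // iota_ge0 oppr_ge0.
pose A' := map_mx iota A.
have A'_normal : A' \is normalmx.
  apply: symmetric_normalmx.
    apply/is_hermitianmxP; rewrite expr0 scale1r map_mx_id //.
    by rewrite /A' map_trmx A_sym.
  by apply/mxOverP => i j; rewrite mxE.
have /orthomx_spectralP AE := A'_normal.
set P := spectralmx A' in AE; set D := spectral_diag A' in AE.
have P_unitary : P \is unitarymx := spectral_unitarymx A'.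
have P_unit : P \in unitmx := spectral_unit A'.
have D_ge0 i : 0 <= D 0 i.
  have : eigenvalue A' (D 0 i).
    apply/eigenvalueP; exists (row i P); last first.
      apply/eqP => Pi0; have /(congr1 (row i)) := mulmxV P_unit.
      rewrite row_mul Pi0 mul0mx => /matrixP/(_ 0 i)/eqP.
      by rewrite !mxE eqxx eq_sym oner_eq0.
    rewrite -row_mul {1}AE !mulmxA mulmxV // mul1mx row_mul.
    by rewrite row_diag_mx -scalemxAl -rowE.
  rewrite eigenvalue_root_char -map_char_poly A_char rmorph_prod /=.
  have -> : \prod_(x <- r) map_poly iota ('X - x%:P) =
            \prod_(x <- [seq iota x | x <- r]) ('X - x%:P).
    by rewrite big_map; apply: eq_bigr => x _; rewrite map_polyXsubC.
  by rewrite root_prod_XsubC => /mapP[x /r_ge0 x0 ->]; rewrite iota_ge0.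
pose y := map_mx iota u *m invmx P.
have yT : map_mx Num.conj y^T = P *m map_mx iota u^T.
  rewrite /y trmx_mul map_mxM invmx_unitary //; congr (_ *m _).
    by apply/matrixP => i j; rewrite !mxE; exact: conjCK.
  by apply/matrixP => i j; rewrite !mxE; exact: conj_Creal.
have eq1 : map_mx iota (u *m A *m u^T) = y *m diag_mx D *m map_mx Num.conj y^T.
  by rewrite yT !map_mxM -/A' AE /y !mulmxA.
have := congr1 (fun M : 'M_1 => M 0 0) eq1; rewrite mxE => e.
rewrite -iota_ge0 e mxE sumr_ge0 // => i _; rewrite !mxE.
rewrite (bigD1 i) //= big1 ?addr0 => [|j ji]; last first.
  by rewrite !mxE (negPf ji) mulr0n mulr0.
by rewrite !mxE eqxx mulr1n mulrAC mulr_ge0 // mul_conjC_ge0.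
Qed.

Section AffineDiagram.
Variables (R : realType) (k : nat) (m : 'I_k -> 'I_k -> nat).
Hypothesis m_sym : forall i j, m i j = m j i.
Hypothesis m_con : forall i j, connect (diagram m) i j.

Definition cartanZ i j : int :=
  if i == j then 2 else if diagram m i j then -1 else 0.

Lemma cartanZE i j : cartan R m i j = (cartanZ i j)%:~R.
Proof. by rewrite mxE /cartanZ; do ?case: ifP. Qed.

Lemma diagram_sym i j : diagram m i j = diagram m j i.
Proof. by rewrite /diagram eq_sym m_sym. Qed.

Lemma cartanZC i j : cartanZ i j = cartanZ j i.
Proof. by rewrite /cartanZ eq_sym diagram_sym. Qed.

Lemma cartanZ_row (S : pzRingType) (f : 'I_k -> S) i :
  \sum_j (cartanZ i j)%:~R * f j = f i *+ 2 - \sum_(j | diagram m i j) f j.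
Proof.
rewrite (bigD1 i) //= {1}/cartanZ eqxx mulr_natl; congr (_ + _).
rewrite -sumrN big_mkcond [RHS]big_mkcond; apply: eq_bigr => j _ /=.
rewrite /cartanZ /diagram eq_sym; case: eqP => //= _.
by case: (m i j == 2%N); rewrite ?mul0r // mulrN1z mulN1r.
Qed.

Hypothesis m_affine : mx_signature (cartan R m) k.-1 0 1.

Lemma integral_kernel : exists v : 'I_k -> int,
  (exists i, v i != 0) /\ forall i, \sum_j cartanZ i j * v j = 0.
Proof.
pose A : 'M[int]_k := \matrix_(i, j) cartanZ i j.
have AE : map_mx intr A = cartan R m.
  by apply/matrixP => i j; rewrite [LHS]mxE mxE -cartanZE.
have : \det A == 0.
  rewrite -(eqr_int R) -det_map_mx AE.
  have [r [charE _ _ r0]] := m_affine.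
  have r0P : 0 \in r by rewrite -has_pred1 has_count r0.
  have := char_poly_det (cartan R m); rewrite charE -horner_coef0.
  have /rootP -> : root (\prod_(x <- r) ('X - x%:P)) 0 by rewrite
    root_prod_XsubC.
  by move/esym/eqP; rewrite mulf_eq0 signr_eq0.
case/det0P=> v v0 vA; exists (fun i => v 0 i); split.
  apply/existsP; apply: contraNT v0; rewrite negb_exists => /forallP v0.
  by apply/eqP/rowP => i; rewrite mxE; have := v0 i; rewrite negbK => /eqP.
move=> i; have /rowP/(_ i) := vA; rewrite !mxE => e; rewrite -[RHS]e.
by apply: eq_bigr => j _; rewrite mxE cartanZC mulrC.
Qed.

Lemma cartan_psd (u : 'rV[R]_k) : 0 <= std_form m u u.
Proof.
have [r [charE _ r_neg _]] := m_affine; apply: (psd_of_spectrum _ charE).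
  by apply/matrixP => i j; rewrite mxE cartanC.
move=> x xr; rewrite leNgt; apply/negP => x0.
by move/eqP: r_neg; rewrite -leqn0 leqNgt -has_count => /hasP[]; exists x.
Qed.

(** The Perron-Frobenius argument: passing from an integral kernel vector v to
its entrywise absolute value does not increase the semidefinite form, so |v| is
a zero of the form, hence in its kernel; a zero entry of a nonnegative kernel
vector spreads to the neighbours. *)
Lemma affine_marks : exists mk : 'I_k -> nat, (forall i, (0 < mk i)%N) /\
  forall i, (2 * mk i = \sum_(j | diagram m i j) mk j)%N.
Proof.
have [v [[i0 vi0] vker]] := integral_kernel.
pose q (u : 'rV[R]_k) := std_form m u u.
pose V : 'rV[R]_k := \row_i (v i)%:~R; pose W : 'rV[R]_k := \row_i `|(v i)%:~R|.
have qV : q V = 0.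
  rewrite /q std_formE big1 // => i _.
  transitivity ((v i)%:~R * (\sum_j cartanZ i j * v j)%:~R : R); last first.
    by rewrite vker mulr0.
  rewrite rmorph_sum big_distrr /=; apply: eq_bigr => j _.
  by rewrite cartanZE !mxE intrM mulrA.
have qW : q W = 0.
  apply/le_anti; rewrite cartan_psd andbT -[leRHS]qV /q !std_formE.
  apply: ler_sum => i _; apply: ler_sum => j _; rewrite !mxE.
  case: eqP => [<-|_]; last case: ifP => _.
  - move: ((v i)%:~R : R) => x.
    by rewrite mulrAC [leRHS]mulrAC -!expr2 real_normK ?num_real.
  - move: ((v i)%:~R : R) ((v j)%:~R : R) => x y.
    by rewrite !mulrN1 !mulNr lerN2 -normrM; exact: ler_norm.
  - by rewrite !mulr0 !mul0r.
have Wker i : std_form m (simple_root R i) W = 0.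
  (* the minimum of the form on the line through W in direction i *)
  set b := std_form _ _ _;
    have := cartan_psd ((- b / 2) *: simple_root R i + W).
  rewrite std_formDl !std_formDr // std_form_roots cartan_diag.
  rewrite (std_formC m_sym W) -/b -/(q W) qW => ge0.
  apply/eqP; rewrite -sqrf_eq0 eq_le sqr_ge0 andbT -oppr_ge0.
  have -> : - b ^+ 2 = 2 * (- b / 2 * (- b / 2 * 2 + b) + (- b / 2 * b + 0)).
    by field.
  by rewrite mulr_ge0.
exists (fun i => `|v i|%N).
have harm i : (2 * `|v i| = \sum_(j | diagram m i j) `|v j|)%N.
  have WE j : W 0 j = (`|v j|%N)%:R by rewrite mxE -intr_norm natr_absz.
  have : \sum_j (cartanZ i j)%:~R * W 0 j = 0.
    rewrite -[RHS](Wker i) std_form_root.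
    by apply: eq_bigr => j _; rewrite cartanZE.
  rewrite cartanZ_row WE => /eqP;
    rewrite subr_eq0 (eq_bigr _ (fun j _ => WE j)).
  by rewrite -natr_sum -mulrnA mulnC eqr_nat => /eqP.
split=> // i; rewrite lt0n; apply/negP => /eqP vi.
suff : `|v i0|%N = 0%N by move=> e; move: vi0; rewrite -absz_eq0 e.
apply: (connect_ind (P := fun j => `|v j|%N = 0%N) m_con vi) => j l jl vj.
have := harm j; rewrite vj muln0 => /esym/eqP; rewrite sum_nat_eq0.
by move/forallP/(_ l)/implyP/(_ jl)/eqP.
Qed.

End AffineDiagram.
(** * Constructors of forms, linear maps and finite sets *)

Lemma symmetric_exists (R : realType) (V : vectType R) (B : V -> V -> R) :
  (forall w c u v, B w (c *: u + v) = c * B w u + B w v) ->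
  (forall u v, B u v = B v u) ->
  exists f : {symmetric V}, forall u v, f u v = B u v.
Proof.
move=> B_lin B_sym.
have B0 w : B w 0 = 0 by have := B_lin w 1 0 0; rewrite scaler0 addr0; lra.
have BZ w c v : B w (c *: v) = c * B w v.
  by have := B_lin w c v 0; rewrite !addr0 B0 addr0.
have BB w : zmod_morphism (B w).
  by move=> u v; rewrite addrC -scaleN1r B_lin mulN1r addrC.
pose bil := isBilinear.Build R V V R *%R (idfun \; *%R) B
  (fun w u v => etrans (etrans (B_sym _ _) (BB w u v))
     (congr2 (fun x y => x - y) (B_sym _ _) (B_sym _ _)))
  BB (fun w c u => etrans (etrans (B_sym _ _) (BZ w c u))
     (congr1 ( *%R c) (B_sym _ _))) BZ.
have herm u v : B u v = (-1) ^+ false * idfun (B v u).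
  by rewrite expr0 mul1r.
pose f : {symmetric V} := HB.pack B bil
  (isHermitianSesquilinear.Build R V false idfun B herm).
by exists f.
Qed.

Lemma hom_exists (K : fieldType) (V W : vectType K) (f : V -> W) : linear f ->
  exists h : 'Hom(V, W), forall v, h v = f v.
Proof.
move=> lf.
pose fL : {linear V -> W} := HB.pack f (GRing.isLinear.Build _ _ _ _ f lf).
by exists (linfun fL) => v; rewrite lfunE.
Qed.

Lemma ordinal_from (k : nat) (i0 : 'I_k) : exists n (sg : 'I_n.+1 -> 'I_k) sg',
  [/\ cancel sg sg', cancel sg' sg, sg ord0 = i0 & k = n.+1].
Proof.
case: k i0 => [[]//|n] i0.
pose sg i := if i == ord0 then i0 else if i == i0 then ord0 else i.
have sgK : involutive sg.
  move=> i; rewrite /sg; have [->|ni0] := eqVneq i ord0.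
    by rewrite eqxx; case: eqP.
  by have [->|nii] := eqVneq i i0; rewrite ?eqxx // (negPf ni0) (negPf nii).
by exists n, sg, sg; split=> //; rewrite /sg eqxx.
Qed.

Lemma integral_box_finite (R : realType) (k : nat) (N : nat) :
  finite_set [set v : 'rV[R]_k |
    forall i, exists2 z : int, v 0 i = z%:~R & `|z| <= N%:Z].
Proof.
pose f (g : {ffun 'I_k -> 'I_(N + N).+1}) : 'rV[R]_k :=
  \row_i ((g i)%:Z - N%:Z)%:~R.
apply: (@sub_finite_set _ _ (f @` setT)); last first.
  by apply: finite_image; exact: finite_finset.
move=> v /= v_int.
have /boolp.choice[z zP] : forall i,
    exists z : int, v 0 i = z%:~R /\ `|z| <= N%:Z.
  by move=> i; have [z zE zN] := v_int i; exists z.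
exists [ffun i => inord (absz (z i + N%:Z))] => //; apply/rowP => i.
have [zE zN] := zP i; rewrite mxE ffunE zE; congr (_%:~R).
by rewrite inordK; lia.
Qed.

(** * Normalised marks and the affine form *)

Section NormalMarks.
Variables (k : nat) (e : rel 'I_k) (mk : 'I_k -> nat) (t : 'I_k).
Hypothesis e_sym : symmetric e.
Hypothesis e_irr : irreflexive e.
Hypothesis e_star : is_star e.
Hypothesis t_max : forall i, (degree e i <= degree e t)%N.
Hypothesis mk_gt0 : forall i, (0 < mk i)%N.
Hypothesis mk_harm : forall i, (2 * mk i = \sum_(j | e i j) mk j)%N.

Lemma normal_marks : exists (n : 'I_k -> nat) (i0 : 'I_k),
  [/\ forall i, (0 < n i)%N, forall i, (2 * n i = \sum_(j | e i j) n j)%N,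
      n i0 = 1%N, forall i, (n i <= n t)%N & forall i, n i = n t -> i = t].
Proof.
have [i0 dvd] := mark_dvd_all e_sym e_irr e_star t_max mk_gt0 mk_harm.
pose n i := (mk i %/ mk i0)%N.
have nE i : (n i * mk i0 = mk i)%N by exact: divnK.
have n_gt0 i : (0 < n i)%N by have := mk_gt0 i; rewrite -nE muln_gt0 => /andP[].
have n_harm i : (2 * n i = \sum_(j | e i j) n j)%N.
  apply/eqP; rewrite -(eqn_pmul2r (mk_gt0 i0)) -mulnA nE mk_harm big_distrl /=.
  by apply/eqP; apply: eq_bigr => j _; rewrite nE.
exists n, i0; split=> //; first by rewrite /n divnn mk_gt0.
- exact: (mark_le e_sym e_irr e_star t_max n_gt0 n_harm).
- exact: (mark_uniq e_sym e_irr e_star t_max n_gt0 n_harm).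
Qed.

End NormalMarks.

Section AffineForm.
Variables (R : realType) (k : nat) (m : 'I_k -> 'I_k -> nat) (n : 'I_k -> nat).
Hypothesis m_sym : forall i j, m i j = m j i.
Hypothesis m_con : forall i j, connect (diagram m) i j.
Hypothesis n_gt0 : forall i, (0 < n i)%N.
Hypothesis n_harm : forall i, (2 * n i = \sum_(j | diagram m i j) n j)%N.

Local Notation q u := (std_form m u u).

Lemma std_form_row i (u : 'rV[R]_k) :
  std_form m (simple_root R i) u = u 0 i *+ 2 - \sum_(j | diagram m i j) u 0 j.
Proof.
rewrite std_form_root -cartanZ_row; apply: eq_bigr => j _.
by rewrite cartanZE.
Qed.

Lemma std_form_rows (u v : 'rV[R]_k) :
  std_form m u v = \sum_i u 0 i * std_form m (simple_root R i) v.
Proof.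
rewrite std_formE; apply: eq_bigr => i _; rewrite std_form_root big_distrr /=.
by apply: eq_bigr => j _; rewrite mulrA.
Qed.

Lemma null_root_form (u : 'rV[R]_k) : std_form m u (\row_i (n i)%:R) = 0.
Proof.
rewrite std_form_rows big1 // => i _; rewrite std_form_row.
rewrite (eq_bigr (fun j => (n j)%:R)) => [|j _]; last by rewrite mxE.
by rewrite mxE -natr_sum -n_harm mulnC natrM mulr_natr subrr mulr0.
Qed.

(** The affine form is a sum of squares over the bonds, each bond counted twice
on the left. *)
Lemma form_squares (u : 'rV[R]_k) :
  \sum_i \sum_(j | diagram m i j)
    (n i)%:R * (n j)%:R * (u 0 i / (n i)%:R - u 0 j / (n j)%:R) ^+ 2 = q u *+ 2.
Proof.
have nz i : (n i)%:R != 0 :> R by rewrite pnatr_eq0 -lt0n.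
pose A i j := (n j)%:R * (u 0 i ^+ 2 / (n i)%:R).
transitivity (\sum_i \sum_(j | diagram m i j)
   (A i j + A j i - (u 0 i * u 0 j) *+ 2)).
  apply: eq_bigr => i _; apply: eq_bigr => j _; rewrite /A.
  by have := nz i; have := nz j => *; field; apply/andP.
have half i : \sum_(j | diagram m i j) A i j = u 0 i ^+ 2 *+ 2.
  rewrite /A -big_distrl /= -natr_sum -n_harm natrM.
  by have := nz i => nz_i; field.
have other : \sum_i \sum_(j | diagram m i j) A j i = \sum_i u 0 i ^+ 2 *+ 2.
  rewrite (exchange_big_dep xpredT) //=; apply: eq_bigr => i _.
  by rewrite -half; apply: eq_bigl => j; exact: diagram_sym.
have split_sum i :
    \sum_(j | diagram m i j) (A i j + A j i - (u 0 i * u 0 j) *+ 2)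
    = u 0 i ^+ 2 *+ 2 - u 0 i * (\sum_(j | diagram m i j) u 0 j) *+ 2
      + \sum_(j | diagram m i j) A j i.
  rewrite sumrB big_split /= half sumrMnl addrAC.
  by congr (_ - _ *+ 2 + _); rewrite big_distrr.
rewrite (eq_bigr _ (fun i _ => split_sum i)) big_split /= other -big_split /=.
rewrite std_form_rows -sumrMnl; apply: eq_bigr => i _.
by rewrite std_form_row; ring.
Qed.

(** Along a bond u i / n i varies by at most 2, by the squares above, and it
vanishes at i0. *)
Lemma connected_bound (P : set 'rV[R]_k) i0 :
  (forall u, P u -> u 0 i0 = 0) -> (forall u, P u -> q u <= 2) ->
  forall i, exists N : nat, forall u, P u -> `|u 0 i| <= N%:R.
Proof.
move=> P0 Pq; apply: (connect_ind m_con (i0 := i0)).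
  by exists 0%N => u Pu; rewrite P0 ?normr0.
move=> i j ij [N Nb]; exists (n j * (N + 2))%N => u Pu.
have ni : (1 : R) <= (n i)%:R by rewrite ler1n.
have nj : (1 : R) <= (n j)%:R by rewrite ler1n.
set x := u 0 i / (n i)%:R; set y := u 0 j / (n j)%:R.
have sq_le : (x - y) ^+ 2 <= 2 ^+ 2.
  have term_ge0 i' j' : 0 <= (n i')%:R * (n j')%:R *
      (u 0 i' / (n i')%:R - u 0 j' / (n j')%:R) ^+ 2 :> R.
    by rewrite mulr_ge0 ?sqr_ge0 // mulr_ge0.
  have : (n i)%:R * (n j)%:R * (x - y) ^+ 2 <= q u *+ 2.
    rewrite -form_squares (bigD1 i) //= (bigD1 j) //= -addrA lerDl.
    apply: addr_ge0; apply: sumr_ge0 => l _; first exact: term_ge0.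
    by apply: sumr_ge0 => l' _; exact: term_ge0.
  have q2 := Pq u Pu => le; apply: le_trans (le_trans le _).
    by rewrite ler_peMl ?sqr_ge0 // mulr_ege1.
  by move: q2; move: (q u) => z; lra.
have xy : `|x - y| <= 2 by rewrite -ler_sqr ?nnegrE // real_normK ?num_real.
have -> : u 0 j = (n j)%:R * y by rewrite mulrC divfK // gt_eqF //
  (lt_le_trans ltr01).
rewrite normrM ger0_norm // natrM ler_pM2l ?(lt_le_trans ltr01 nj) // natrD.
have -> : y = x - (x - y) by rewrite opprB addrC subrK.
apply: le_trans (ler_normB _ _) _; apply: lerD => //.
apply: le_trans (Nb u Pu); rewrite normrM [X in _ * X]ger0_norm ?invr_ge0 //.
by rewrite ler_piMr // invf_le1 // (lt_le_trans ltr01).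
Qed.

(** The maximum principle for the ratio u i / n i: where it is maximal, it is
also maximal at the neighbours. *)
Lemma kernel_line (u : 'rV[R]_k) i0 : n i0 = 1%N ->
  (forall i, std_form m (simple_root R i) u = 0) ->
  forall i, u 0 i = u 0 i0 * (n i)%:R.
Proof.
move=> n1 u_ker.
have nz i : (n i)%:R != 0 :> R by rewrite pnatr_eq0 -lt0n.
have n0 i : 0 < (n i)%:R :> R by rewrite ltr0n.
pose F i := u 0 i / (n i)%:R.
have [i1 _ F_max] := @Order.TotalTheory.arg_maxP _ _ _ i0 xpredT F isT.
have F_eq : forall i, F i = F i1.
  apply: (connect_ind m_con (i0 := i1)) => // i j ij Fi.
  pose h l : R := F i1 * (n l)%:R - u 0 l.
  have h_ge0 l : 0 <= h l.
    by rewrite subr_ge0 -ler_pdivrMr //; exact: F_max.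
  have hi : h i = 0 by rewrite /h -Fi divfK ?subrr.
  have : \sum_(l | diagram m i l) h l = 0.
    rewrite sumrB -big_distrr /= -natr_sum -n_harm natrM.
    have := u_ker i; rewrite std_form_row => /eqP; rewrite subr_eq0 => /eqP <-.
    by rewrite -[RHS](mul0r 2) -hi /h; ring.
  move/psumr_eq0P => /(_ (fun l _ => h_ge0 l) j ij) /eqP.
  by rewrite subr_eq0 => /eqP hj; rewrite /F -hj mulfK.
move=> i; have := F_eq i; rewrite -(F_eq i0) /F n1 divr1 => <-.
by rewrite divfK.
Qed.

End AffineForm.
(** * Spans and ordinals *)

Section Spans.
Variables (R : realType) (V : vectType R).
Implicit Types (A : set V) (X : seq V).

Lemma Rspan_min A (P : V -> Prop) :
  P 0 -> (forall c u v, P u -> P v -> P (c *: u + v)) ->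
  (forall x, A x -> P x) -> forall v, Rspan A v -> P v.
Proof.
move=> P0 PD PA v [n [x [c [Ax ->]]]].
elim/big_rec: _ => // i y _ Py; apply: PD => //; exact: PA.
Qed.

Lemma span_min X (P : V -> Prop) :
  P 0 -> (forall c u v, P u -> P v -> P (c *: u + v)) ->
  (forall x, x \in X -> P x) -> forall v, v \in <<X>>%VS -> P v.
Proof.
move=> P0 PD PX v /(coord_span (X := in_tuple X)) ->.
elim/big_rec: _ => // i y _ Py; apply: PD => //; exact/PX/mem_nth.
Qed.

Lemma Rspan_sub A x : A x -> Rspan A x.
Proof.
by move=> Ax; exists 1%N, (fun=> x), (fun=> 1); rewrite big_ord1 scale1r.
Qed.

Lemma RspanP A c u v : Rspan A u -> Rspan A v -> Rspan A (c *: u + v).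
Proof.
move=> [n [x [b [Ax ->]]]] [n' [x' [b' [Ax' ->]]]].
exists (n + n')%N,
  (fun i : 'I_(n + n') => match fintype.split i with inl j => x j | inr j =>
    x' j end),
  (fun i : 'I_(n + n') => match fintype.split i with inl j =>
    c * b j | inr j => b' j end).
split=> [i|]; first by case: fintype.split.
rewrite big_split_ord /= scaler_sumr; congr (_ + _); apply: eq_bigr => i _.
  by case: split_ordP => j /eqP; rewrite ?eq_lshift ?eq_lrshift // => /eqP ->;
    rewrite scalerA.
by case: split_ordP => j /eqP; rewrite ?eq_rshift ?eq_rlshift // => /eqP ->.
Qed.

Lemma Rspan0 A : Rspan A 0.
Proof.
by exists 0%N, (fun=> 0), (fun=> 0); rewrite big_ord0; split=> // -[].
Qed.

Lemma Rspan_sum A I (r : seq I) (c : I -> R) (x : I -> V) :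
  (forall i, Rspan A (x i)) -> Rspan A (\sum_(i <- r) c i *: x i).
Proof.
move=> Ax; elim/big_rec: _ => [|i y _ Ay]; first exact: Rspan0.
exact: RspanP.
Qed.

Lemma Zspan_bigsum A I (r : seq I) (c : I -> int) (x : I -> V) :
  (forall i, Zspan A (x i)) -> Zspan A (\sum_(i <- r) x i *~ c i).
Proof.
move=> Ax; elim/big_rec: _ => [|i y _ Ay]; first exact: Zspan0.
by apply: ZspanD => //; exact: ZspanMz.
Qed.

End Spans.

Lemma mem_codom_ord (T : eqType) n (x : 'I_n -> T) v :
  v \in [seq x i | i : 'I_n] -> exists i, v = x i.
Proof. by case/mapP=> i _ ->; exists i. Qed.

Lemma codom_ord_mem (T : eqType) n (x : 'I_n -> T) i :
  x i \in [seq x i | i : 'I_n].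
Proof. by apply/mapP; exists i; rewrite ?mem_enum. Qed.

Lemma nth_codom_ord (T : Type) (x0 : T) n (x : 'I_n -> T) (i : 'I_n) :
  nth x0 [seq x i | i : 'I_n] i = x i.
Proof. by rewrite -[RHS](tnth_mktuple x) (tnth_nth x0). Qed.

Lemma char_poly_cast (K : nzRingType) n n' (h : n = n') (A : 'M[K]_n) :
  char_poly (castmx (h, h) A) = char_poly A.
Proof. by case: n' / h. Qed.

(** * The tubular system of an affine star and its hyperbolic cover *)

(** The system lives on V = R^k + R a, where R^k carries the standard form and
a is radical; V / U is R^k. The vertex i0 of mark 1 is the affine node. The
forms and linear maps enter through their defining equations. *)
Section AffineCover.
Variables (R : realType) (E : ext_coxeter R).
Local Notation k := (ext_k E).
Local Notation m := (@ext_m R E).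
Local Notation rho := (@ext_rho R E).
Local Notation root i := (simple_root R i).
Local Notation L := (cox_roots rho).
Local Notation q := (std_form m).

Variables (n : 'I_k -> nat) (i0 : 'I_k) (N : nat).
Variables (sg : 'I_N.+1 -> 'I_k) (sg' : 'I_k -> 'I_N.+1).
Hypothesis E_affine : affine_diagram E.
Hypothesis n_gt0 : forall i, (0 < n i)%N.
Hypothesis n_harm : forall i, (2 * n i = \sum_(j | diagram m i j) n j)%N.
Hypothesis n_i0 : n i0 = 1%N.
Hypothesis n_max : forall i, (n i <= n (ext_t E))%N.
Hypothesis n_uniq : forall i, n i = n (ext_t E) -> i = ext_t E.
Hypothesis sgK : cancel sg sg'.
Hypothesis sg'K : cancel sg' sg.
Hypothesis sg0 : sg ord0 = i0.
Hypothesis kE : k = N.+1.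

Let m_sym := @ext_m_sym R E.
Let m_con : forall i j, connect (diagram m) i j.
Proof. by have [[]] := ext_star E. Qed.

Local Notation Q := 'rV[R]_k.
Local Notation V := ('rV[R]_k * R^o)%type.

Definition affine_Phi : set V := [set v | L v.1 /\ (v.2 : R) \is a Num.int].
Local Notation Phi := affine_Phi.
Local Notation a := ((0, 1) : V).

Variables (B : {symmetric V}) (BQ : {symmetric Q}) (pi : 'Hom(V, Q)).
Hypothesis BE : forall u v, B u v = q u.1 v.1.
Hypothesis BQE : forall u v, BQ u v = q u v.
Hypothesis piE : forall v, pi v = v.1.

Definition null_root : 'rV[R]_k := \row_i (n i)%:R.

Lemma q_null u : q u null_root = 0.
Proof. exact: null_root_form. Qed.

Lemma sum_sg (W : nmodType) (f : 'I_k -> W) :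
  \sum_i f i = f i0 + \sum_(j < N) f (sg (lift ord0 j)).
Proof.
rewrite (reindex sg) /=; last by exists sg' => ? _; rewrite ?sgK ?sg'K.
by rewrite big_ord_recl sg0.
Qed.

Lemma sg_lift_neq j : sg (lift ord0 j) != i0.
Proof. by rewrite -sg0 (inj_eq (can_inj sgK)). Qed.

Lemma comb_coord (I : finType) (f : I -> 'I_k) (c : I -> R) : injective f ->
  forall i, (\sum_j c j *: root (f j)) 0 (f i) = c i.
Proof.
move=> f_inj i; rewrite summxE (bigD1 i) //= big1 => [|j ji].
  by rewrite !mxE !eqxx mulr1 addr0.
by rewrite !mxE (inj_eq f_inj) eq_sym (negPf ji) mulr0.
Qed.

Lemma sum_pair_fst (I : Type) (r : seq I) (f : I -> V) :
  (\sum_(i <- r) f i).1 = \sum_(i <- r) (f i).1.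
Proof. exact: (big_morph (fun v : V => v.1)). Qed.

Lemma sum_pair_snd (I : Type) (r : seq I) (f : I -> V) :
  (\sum_(i <- r) f i).2 = \sum_(i <- r) (f i).2.
Proof. exact: (big_morph (fun v : V => v.2)). Qed.

Lemma pair_decomp (v : V) :
  v = \sum_i v.1 0 i *: ((root i, 0) : V) + (v.2 : R) *: a.
Proof.
apply: injective_projections.
  transitivity ((\sum_i v.1 0 i *: ((root i,
    0) : V)).1 + (v.2 : R) *: (0 : Q)) => //.
  by rewrite sum_pair_fst scaler0 addr0 {1}[v.1]row_simple_roots.
transitivity ((\sum_i v.1 0 i *: ((root i,
  0) : V)).2 + (v.2 : R) * (1 : R)) => //.
rewrite sum_pair_snd mulr1 big1 ?add0r // => i _.
by rewrite /= scaler0.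
Qed.

Lemma Phi_norm al : Phi al -> B al al = 2.
Proof. by case=> Ll _; rewrite BE cox_root_norm. Qed.

Lemma Phi_root i (c : int) : Phi (root i, c%:~R).
Proof. by split; [exact: cox_root_simple | rewrite /= intr_int]. Qed.

Lemma Zspan_Phi v : Zspan Phi v <->
  (forall i, v.1 0 i \is a Num.int) /\ (v.2 : R) \is a Num.int.
Proof.
split.
  move: v; apply: (Zspan_min (P := fun v : V =>
    (forall i, v.1 0 i \is a Num.int) /\
    (v.2 : R) \is a Num.int)) => [|u v [u1 u2] [v1 v2]|v [Lv v2]].
  - by split=> [i|]; rewrite ?mxE rpred0.
  - by split=> [i|] /=; rewrite ?mxE rpredB.
  - by split=> // i; exact: cox_root_int.
case: v => u c [/= u_int /intrP[z zE]].
have /boolp.choice[w wE] : forall i, exists z : int, u 0 i = z%:~R.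
  by move=> i; apply/intrP.
have aE : Zspan Phi a.
  have -> : a = (root i0, 1%:~R) - (root i0, 0%:~R).
    by apply: injective_projections; rewrite /= ?subrr ?subr0.
  by apply: ZspanB; apply: Zspan_sub; exact: Phi_root.
rewrite [(u, c)]pair_decomp /=; apply: ZspanD; last first.
  by rewrite zE scaler_int; exact: ZspanMz.
rewrite (eq_bigr (fun i => ((root i, 0%:~R) : V) *~ w i)) => [|i _].
  by apply: Zspan_sum => i; exact: Phi_root.
by rewrite wE scaler_int.
Qed.

Definition coord_basis (i : 'I_(k + 1)) : V :=
  match fintype.split i with inl j => (root j, 0) | inr _ => a end.
Local Notation X := [seq coord_basis i | i : 'I_(k + 1)].

Lemma coord_basis_lshift j : coord_basis (lshift 1 j) = (root j, 0).
Proof. by rewrite /coord_basis (unsplitK (inl j)). Qed.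

Lemma coord_basis_rshift j : coord_basis (rshift k j) = a.
Proof. by rewrite /coord_basis (unsplitK (inr j)). Qed.

Lemma coord_basis_sum (c : 'I_(k + 1) -> R) : \sum_i c i *: coord_basis i =
  (\row_j c (lshift 1 j), c (rshift k ord0)).
Proof.
rewrite big_split_ord big_ord1 /= coord_basis_rshift [RHS]pair_decomp /=;
  congr (_ + _).
by apply: eq_bigr => i _; rewrite coord_basis_lshift mxE.
Qed.

Lemma coord_basis_decomp v : exists2 c, v = \sum_i c i *: coord_basis i &
  forall i, c i = match fintype.split i with inl j => v.1 0 j | inr _ =>
    v.2 end.
Proof.
exists (fun i => match fintype.split i with inl j => v.1 0 j | inr _ =>
  v.2 end) => //.
rewrite coord_basis_sum; apply: injective_projections => /=.
  by apply/rowP => j; rewrite mxE (unsplitK (inl j)).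
by rewrite (unsplitK (inr ord0)).
Qed.

Lemma coord_basis_basis : basis_of fullv X.
Proof.
apply/andP; split.
  rewrite eqEsubv subvf; apply/subvP => v _;
    have [c -> _] := coord_basis_decomp v.
  by apply: memv_suml => i _; apply/memvZ/memv_span/codom_ord_mem.
apply/free_ordP => c; rewrite coord_basis_sum => -[/rowP c1 c2] i.
by case: (split_ordP i) => j ->; [have := c1 j; rewrite !mxE | rewrite ord1].
Qed.

Lemma coord_basis_lattice : Zspan Phi = Zspan [set` X].
Proof.
apply/seteqP; split; last first.
  apply: Zspan_le => v /= /mem_codom_ord[i ->]; apply/Zspan_Phi.
  rewrite /coord_basis; case: fintype.split => j /=; rewrite ?rpred0 ?rpred1;
    split=> // l.
    by apply: cox_root_int; exact: cox_root_simple.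
  by rewrite mxE rpred0.
move=> v /Zspan_Phi[v1 v2]; have [c vE cE] := coord_basis_decomp v.
have /boolp.choice[z zE] : forall i, exists z : int, c i = z%:~R.
  by move=> i; apply/intrP; rewrite cE; case: fintype.split => ?;
    [exact: v1 | exact: v2].
rewrite vE (eq_bigr (fun i => coord_basis i *~ z i)) => [|i _].
  by apply: Zspan_sum => i; exact: codom_ord_mem.
by rewrite zE scaler_int.
Qed.

Lemma Phi_gen : gen_root_system B fullv Phi.
Proof.
split.
- by exists (root i0, 0%:~R); exact: Phi_root.
- by move=> al /Phi_norm ->; rewrite pnatr_eq0.
- apply/seteqP; split=> v _ /=; first by rewrite memvf.
  have Pi i (c : int) : Rspan Phi (root i, c%:~R) by apply: Rspan_sub;
    exact: Phi_root.
  have Pa : Rspan Phi a.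
    have -> : a = (-1) *: (root i0, 0%:~R) + (root i0, 1%:~R).
      apply: injective_projections; first by rewrite /= scaleN1r addNr.
      by rewrite /= mulr0z scaler0 add0r.
    exact: RspanP.
  rewrite [v]pair_decomp addrC; apply: RspanP => //.
  by apply: Rspan_sum => i; exact: (Pi i 0).
- move=> al be Pal Pbe; rewrite reflE ?Phi_norm //.
  case: Pal Pbe => La a2 [Lb b2]; rewrite BE; split.
    exact: cox_root_refl.
  by rewrite /= rpredB // -[_ *: _]/(_ * _) rpredM // cox_root_form_int.
- move=> al be Pal Pbe; rewrite (Phi_norm Pbe) [2 * _]mulrC mulfK ?pnatr_eq0 //.
  by rewrite BE cox_root_form_int //; [case: Pal | case: Pbe].
by exists X; split; [exact: coord_basis_basis | exact: coord_basis_lattice].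
Qed.

(** The simple roots all lie on one side of an orthogonal decomposition, by
connectedness; a root orthogonal to all of them would have norm 0. *)
Lemma Phi_irreducible : irreducible B Phi.
Proof.
case=> E1 [E2 [P1 [P2 [G1 G2 PE orth]]]].
have cover i : P1 (root i, 0) \/ P2 (root i, 0).
  have : Phi (root i, 0%:~R) by exact: Phi_root.
  by rewrite PE.
have one_sided (P P' : set V) i1 : (forall i, P (root i, 0) \/ P' (root i,
  0)) ->
    (forall u v, P u -> P' v -> B u v = 0) -> P (root i1, 0) ->
    forall i, P (root i, 0).
  move=> cov PP' P1i; apply: (connect_ind m_con P1i) => i j ij Pi.
  case: (cov j) => // P'j; have := PP' _ _ Pi P'j.
  rewrite BE /= std_form_roots mxE ij; have /andP[/negPf-> _] := ij.
  by move/eqP; rewrite oppr_eq0 oner_eq0.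
have no_other (P' : set V) : P' `<=` Phi -> P' !=set0 ->
    (forall i v, P' v -> B (root i, 0) v = 0) -> False.
  move=> sub [v P'v] v0; have := Phi_norm (sub _ P'v).
  rewrite BE std_form_rows big1 => [/eqP|i _];
    first by rewrite eq_sym pnatr_eq0.
  by have := v0 i v P'v; rewrite BE /= => ->; rewrite mulr0.
have [Pi|Pi] := cover i0.
  apply: (no_other P2); [by rewrite PE; right | exact: grs_nonempty G2 |].
  by move=> i v P2v; exact: orth (one_sided P1 P2 i0 cover orth Pi i) P2v.
apply: (no_other P1); [by rewrite PE; left | exact: grs_nonempty G1 |].
have orth' u v : P2 u -> P1 v -> B u v = 0.
  by move=> Pu Pv; rewrite symC; exact: orth.
have cover' i : P2 (root i, 0) \/ P1 (root i, 0).
  by have [] := cover i; [right | left].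
move=> i v; exact: orth' (one_sided P2 P1 i0 cover' orth' Pi i).
Qed.

Lemma Phi_reduced : reduced Phi.
Proof.
move=> al r Pal /Phi_norm; rewrite symZ symC symZ Phi_norm // => e.
have : (r - 1) * (r + 1) = 0 by lra.
move/eqP; rewrite mulf_eq0 subr_eq0 addr_eq0 => /orP[]/eqP; by [left | right].
Qed.

Lemma Phi_signature : form_signature B N 0 2.
Proof.
exists X; split; first exact: coord_basis_basis.
have hX : size X = (k + 1)%N by rewrite size_map -cardE card_ord.
have nthX (i : 'I_(k + 1)) : X`_i = coord_basis i by exact: nth_codom_ord.
have gramE : castmx (hX, hX) (gram B X) = block_mx (cartan R m) 0 0 (0 : 'M_1).
  apply/matrixP => i j; rewrite castmxE mxE /= !nthX BE.
  case: (split_ordP i) => i' ->; case: (split_ordP j) => j' ->.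
  - by rewrite block_mxEul !coord_basis_lshift std_form_roots.
  - by rewrite block_mxEur coord_basis_rshift /= std_formC // std_form0l mxE.
  - by rewrite block_mxEdl coord_basis_rshift /= std_form0l mxE.
  - by rewrite block_mxEdr !coord_basis_rshift /= std_form0l mxE.
have [r [rE r_pos r_neg r_zero]] := E_affine.
have kN : k.-1 = N by rewrite kE.
exists (0 :: r); rewrite /= ltxx eqxx r_pos r_neg r_zero kN; split=> //.
rewrite -(char_poly_cast hX) gramE /char_poly char_block_diag_mx det_ublock.
rewrite -/(char_poly _) rE big_cons mulrC; congr (_ * _).
by rewrite det_mx11 !mxE eqxx.
Qed.

Lemma a_neq0 : a != 0.
Proof. by rewrite xpair_eqE oner_eq0 andbF. Qed.

Lemma a_line v : v \in <[a]>%VS -> v.1 = 0.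
Proof. by case/vlineP=> c ->; rewrite /= scaler0. Qed.

Lemma a_line_radical : [set` <[a]>%VS] `<=` radical B.
Proof.
by move=> v /a_line v1 u; rewrite BE v1 std_form0l.
Qed.

Lemma Zspan_Phi_a : Zspan Phi a.
Proof. by apply/Zspan_Phi; split=> [i|]; rewrite ?mxE ?rpred0 ?rpred1. Qed.

Lemma a_line_lattice : [set` <[a]>%VS] `&` Zspan Phi <> [set 0].
Proof.
move=> e; have : ([set` <[a]>%VS] `&` Zspan Phi) a.
  by split; [exact: memv_line | exact: Zspan_Phi_a].
by rewrite e => /= /eqP; rewrite (negPf a_neq0).
Qed.

Lemma a_generates : Zspan Phi `&` [set` <[a]>%VS] = Zspan [set a].
Proof.
apply/seteqP; split=> v.
  case=> /Zspan_Phi[_ v2] /= /vlineP[c vE]; move: v2; rewrite vE /=.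
  rewrite -[_ *: _]/(c * 1) mulr1 => /intrP[z ->]; rewrite scaler_int.
  by apply/ZspanMz/Zspan_sub.
move=> av; split.
  by move: v av; apply: Zspan_le => _ ->; exact: Zspan_Phi_a.
move: v av; apply: (Zspan_min (P := fun v => [set` <[a]>%VS] v)) => /=.
- exact: mem0v.
- by move=> u v; exact: rpredB.
- by move=> _ ->; exact: memv_line.
Qed.

Lemma pi_kernel : lker pi = <[a]>%VS.
Proof.
apply/vspaceP => v; rewrite memv_ker piE; apply/eqP/idP => [v1|/a_line//].
apply/vlineP; exists v.2; apply: injective_projections; rewrite /= ?scaler0 //.
by rewrite -[_ *: _]/(v.2 * 1) mulr1.
Qed.

Lemma pi_image : limg pi = fullv.
Proof.
apply/vspaceP => u; rewrite memvf; apply/memv_imgP.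
by exists (u, 0); rewrite ?memvf // piE.
Qed.

Lemma pi_form u v : BQ (pi u) (pi v) = B u v.
Proof. by rewrite BQE BE !piE. Qed.

Lemma pi_Phi : pi @` Phi = L.
Proof.
apply/seteqP; split=> [_ [v [Lv _] <-]|v Lv]; first by rewrite piE.
by exists (v, 0); [split; rewrite ?rpred0 | rewrite piE].
Qed.

Lemma sg_signs (c : 'I_k -> nat) :
  \sum_i root i *+ c i = \sum_(j < N.+1) root (sg j) *+ c (sg j).
Proof. by rewrite sum_sg big_ord_recl sg0. Qed.

Lemma beta_basis : root_basis (pi @` Phi) (fun i : 'I_N.+1 => root (sg i)).
Proof.
rewrite pi_Phi; split.
- apply/free_ordP => c c0 i.
  by rewrite -(comb_coord c (can_inj sgK)) c0 mxE.
- by move=> i; exact: cox_root_simple.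
move=> v /cox_root_signs[c cE]; exists (fun i => c (sg i)).
by rewrite -sg_signs.
Qed.

(** The finite root system obtained by deleting the affine node. *)
Definition fin_roots : set Q := [set v | L v /\ v 0 i0 = 0].
Local Notation fin_simple := [seq root (sg (lift ord0 i)) | i : 'I_N].

Lemma fin_free (c : 'I_N -> R) : \sum_i c i *: root (sg (lift ord0 i)) = 0 ->
  forall i, c i = 0.
Proof.
move=> c0 i; rewrite -(comb_coord (f := sg \o lift ord0) c);
  first by rewrite c0 mxE.
by move=> i1 i2 /(can_inj sgK)/lift_inj.
Qed.

Lemma fin_root_simple i : fin_roots (root (sg (lift ord0 i))).
Proof.
split; first exact: cox_root_simple.
by rewrite mxE eqxx eq_sym (negPf (sg_lift_neq i)).
Qed.

Lemma fin_decomp (v : Q) : v 0 i0 = 0 ->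
  v = \sum_(j < N) v 0 (sg (lift ord0 j)) *: root (sg (lift ord0 j)).
Proof.
by move=> v0; rewrite {1}[v]row_simple_roots sum_sg v0 scale0r add0r.
Qed.

Lemma fin_coord v : v \in <<fin_simple>>%VS -> v 0 i0 = 0.
Proof.
move: v; apply: (span_min (P := fun v : Q => v 0 i0 = 0)).
- by rewrite mxE.
- by move=> c u v u0 v0; rewrite !mxE u0 v0 mulr0 addr0.
- by move=> _ /mem_codom_ord[i ->]; have [] := fin_root_simple i.
Qed.

(** The form is positive definite on the vectors with vanishing coordinate at
i0, so that integral vectors of norm 2 are bounded. *)
Lemma fin_finite : finite_set fin_roots.
Proof.
have /boolp.choice[b bP] := connected_bound m_sym m_con n_gt0 n_harm
  (P := fin_roots) (i0 := i0) (fun u Pu => proj2 Pu)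
  (fun u Pu => eq_ind_r (fun x => x <= 2) (lexx _) (cox_root_norm (proj1 Pu))).
apply: (@sub_finite_set _ _ [set v : 'rV[R]_k | forall i,
  exists2 z : int, v 0 i = z%:~R & `|z| <= (\sum_i b i)%N%:Z]); last first.
  exact: integral_box_finite.
move=> v Pv i; have /intrP[z zE] := cox_root_int i (proj1 Pv).
exists z => //; have := bP i v Pv; rewrite zE -intr_norm.
rewrite -[(b i)%:R]/((b i)%:Z%:~R) ler_int => le; apply: le_trans le _.
by rewrite lez_nat (bigD1 i) //= leq_addr.
Qed.

Lemma fin_gen : gen_root_system BQ <<fin_simple>>%VS fin_roots.
Proof.
have N_gt0 : exists j : 'I_N, true.
  have [j ij] : exists j, diagram m i0 j.
    exact: (nbr_exists n_gt0 n_harm).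
  case: (unliftP ord0 (sg' j)) => [l _|jE]; first by exists l.
  move: ij; rewrite /diagram -[j]sg'K jE sg0 eqxx.
  by [].
have norm v : fin_roots v -> BQ v v = 2.
  by case=> Lv _; rewrite BQE cox_root_norm.
split.
- by have [j _] := N_gt0; exists (root (sg (lift ord0 j)));
  exact: fin_root_simple.
- by move=> al /norm ->; rewrite pnatr_eq0.
- apply/seteqP; split=> v.
    move: v; apply: Rspan_min => [|c u v|v [Lv v0]] /=; first exact: mem0v.
      by move=> u1 v1; rewrite rpredD ?rpredZ.
    rewrite [v]fin_decomp //; apply: memv_suml => j _.
    exact/memvZ/memv_span/codom_ord_mem.
  move/fin_coord/fin_decomp => ->; apply: Rspan_sum => j.
  exact/Rspan_sub/fin_root_simple.
- move=> al be Pa Pb; rewrite reflE ?norm //.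
  case: Pa Pb => La a0 [Lb b0]; rewrite BQE; split; first exact: cox_root_refl.
  by rewrite !mxE a0 b0 mulr0 subr0.
- move=> al be Pa Pb; rewrite (norm be) // [2 * _]mulrC mulfK ?pnatr_eq0 //.
  by rewrite BQE cox_root_form_int //; [case: Pa | case: Pb].
exists fin_simple; split.
  by apply/andP; split=> //; apply/free_ordP; exact: fin_free.
apply/seteqP; split; apply: Zspan_le => v.
  case=> Lv v0; rewrite [v]fin_decomp //.
  have /boolp.choice[z zE] : forall j : 'I_N, exists z : int,
      v 0 (sg (lift ord0 j)) = z%:~R.
    by move=> j; apply/intrP; exact: cox_root_int.
  rewrite (eq_bigr (fun j => root (sg (lift ord0 j)) *~ z j)) => [|j _].
    by apply: Zspan_sum => j; exact: codom_ord_mem.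
  by rewrite zE scaler_int.
by move=> /mem_codom_ord[j ->]; apply: Zspan_sub; exact: fin_root_simple.
Qed.

Lemma fin_basis :
  root_basis fin_roots (fun i : 'I_N => root (sg (lift ord0 i))).
Proof.
split; [by apply/free_ordP; exact: fin_free | exact: fin_root_simple |].
move=> v [Lv v0]; have [c cE] := cox_root_signs Lv.
have sumE : (\sum_i root i *+ c i) 0 i0 = (c i0)%:R :> R.
  rewrite (eq_bigr (fun i => (c i)%:R *: root i)) => [|i _];
    last by rewrite scaler_nat.
  by rewrite (comb_coord (f := id)).
have c0 : c i0 = 0%N.
  apply/eqP; rewrite -(eqr_nat R) -sumE; case: cE => e; first by rewrite -e v0.
  by have := v0; rewrite e mxE => /eqP; rewrite oppr_eq0.
exists (fun i => c (sg (lift ord0 i))).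
by move: cE; rewrite sum_sg c0 mulr0n add0r.
Qed.

(** A radical vector of the root lattice is its coordinate at i0 times the null
root, because the null root has coordinate 1 there. *)
Lemma marks_span : Zspan [set \sum_i root (sg i) *+ n (sg i)] =
  Zspan (pi @` Phi) `&` (pi @` radical B).
Proof.
have nullE : \sum_i root (sg i) *+ n (sg i) = null_root.
  rewrite -sg_signs [RHS]row_simple_roots; apply: eq_bigr => i _.
  by rewrite mxE scaler_nat.
rewrite nullE pi_Phi; apply/seteqP; split=> v.
  case=> j [x [c [xE ->]]].
  have -> : \sum_i x i *~ c i = null_root *~ \sum_i c i.
    by rewrite mulrz_sumr; apply: eq_bigr => i _; rewrite (xE i).
  split.
    apply: ZspanMz; rewrite -nullE.
    apply: (Zspan_bigsum _ (fun i => (n (sg i))%:Z)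
                           (x := fun i => root (sg i))) => i.
    exact/Zspan_sub/cox_root_simple.
  exists (null_root *~ (\sum_i c i), 0); last by rewrite piE.
  move=> u; rewrite BE /= std_formC // -scaler_int -[_ *: _]addr0 std_formDr //.
  by rewrite q_null mulr0 std_formC // std_form0l addr0.
case=> Lv [w w_rad wE]; have v_ker i : q (root i) v = 0.
  by have := w_rad (root i, 0); rewrite symC BE /= -wE piE.
have /intrP[z zE] := cox_lattice_int Lv i0.
have -> : v = null_root *~ z.
  apply/rowP => i; rewrite (kernel_line m_con n_gt0 n_harm n_i0 v_ker) zE.
  by rewrite -scaler_int !mxE.
by apply/ZspanMz/Zspan_sub.
Qed.

Definition affine_alpha (i : 'I_N.+1) : V := (root (sg i), 0).
Local Notation alpha := affine_alpha.

Lemma alpha_Phi i : Phi (alpha i).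
Proof. by split; [exact: cox_root_simple | rewrite rpred0]. Qed.

Lemma alpha_pi i : pi (alpha i) = root (sg i).
Proof. exact: piE. Qed.

Lemma Phi_elliptic : elliptic B N Phi.
Proof.
split; [exact: Phi_gen | exact: Phi_irreducible | exact: Phi_reduced |].
exact: Phi_signature.
Qed.

Lemma a_line_dim : \dim (<[a]> : {vspace V}) = 1%N.
Proof. by rewrite dim_vline a_neq0. Qed.

Lemma beta_fin : exists (F : {vspace Q}) (Psi : set Q),
  [/\ Psi `<=` pi @` Phi, finite_set Psi, gen_root_system BQ F Psi
    & root_basis Psi (fun i : 'I_N => root (sg (lift ord0 i)))].
Proof.
exists <<fin_simple>>%VS, fin_roots; split.
- by rewrite pi_Phi => v [].
- exact: fin_finite.
- exact: fin_gen.
- exact: fin_basis.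
Qed.

Lemma mark0 : n (sg ord0) = 1%N. Proof. by rewrite sg0. Qed.

Lemma mark_max i : (n (sg i) <= n (sg (sg' (ext_t E))))%N.
Proof. by rewrite sg'K. Qed.

Lemma mark_max_uniq i : n (sg i) = n (sg (sg' (ext_t E))) -> i = sg' (ext_t E).
Proof. by rewrite sg'K => /n_uniq <-; rewrite sgK. Qed.

Definition affine_tubular : tubular R :=
  Tubular Phi_elliptic Phi_norm a_line_dim a_line_radical a_line_lattice
    a_generates pi_kernel pi_image pi_form beta_basis beta_fin mark0
    (fun i => n_gt0 (sg i)) marks_span alpha_Phi alpha_pi mark_max
      mark_max_uniq.
Local Notation T := affine_tubular.

Local Notation Vh := (V * (R^o * R^o))%type.
Variables (Bh : {symmetric Vh}) (inc : 'Hom(V, Vh)).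
(* The products with a' and b' are the coordinate along a and the coordinate
   at i0, which is 1 on b and 0 on the finite simple roots. *)
Hypothesis BhE : forall u v : Vh, Bh u v = B u.1 v.1 +
  (u.2.1 * v.1.2 + v.2.1 * u.1.2 + (u.2.2 * v.1.1 0 i0 + v.2.2 * u.1.1 0 i0)).
Hypothesis incE : forall v, inc v = (v, 0).
Local Notation a' := ((0, (1, 0)) : Vh).
Local Notation b' := ((0, (0, 1)) : Vh).
Local Notation b := ((null_root, 0) : V).

Lemma tub_bE : tub_b T = b.
Proof.
rewrite /tub_b /= [RHS]pair_decomp /= scale0r addr0 sum_sg big_ord_recl.
congr (_ + _); first by rewrite mxE scaler_nat /affine_alpha sg0.
by apply: eq_bigr => j _; rewrite mxE scaler_nat.
Qed.

Lemma B_null v : B b v = 0.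
Proof. by rewrite symC BE q_null. Qed.

Lemma B_a v : B a v = 0.
Proof. by have := a_line_radical (memv_line a : [set` <[a]>%VS] a); apply. Qed.

Lemma pair_a : hyperbolic_pair Bh (inc a) a'.
Proof.
split; rewrite BhE ?incE /= ?B_a ?(symC _ 0) ?sym0 ?mxE; ring.
Qed.

Lemma pair_b : hyperbolic_pair Bh (inc (tub_b T)) b'.
Proof.
split; rewrite BhE ?incE ?tub_bE /= ?B_null ?(symC _ 0) ?sym0 ?mxE ?n_i0; ring.
Qed.

Lemma Vfin_image x : x \in (inc @: tub_Vfin T)%VS ->
  [/\ x.1.1 0 i0 = 0, x.1.2 = 0 & x.2 = 0].
Proof.
case/memv_imgP=> v vT ->; rewrite incE /=.
suff [] : v.1 0 i0 = 0 /\ v.2 = 0 by [].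
move: v vT; apply: (span_min (P := fun v : V => v.1 0 i0 = 0 /\ v.2 = 0)).
- by rewrite mxE.
- by move=> c u v [u1 u2] [v1 v2];
  rewrite /= !mxE u1 u2 v1 v2 mulr0 scaler0 !addr0.
move=> _ /mem_codom_ord[i ->]; split=> //=.
by have [] := fin_root_simple i.
Qed.

Lemma span_pair (W : vectType R) (x y v : W) : v \in <<[:: x; y]>>%VS ->
  exists c d, v = c *: x + d *: y.
Proof.
rewrite span_cons span_seq1 => /memv_addP[_ /vlineP[c ->] [_ /vlineP[d ->] ->]].
by exists c, d.
Qed.

Lemma mem_span_pair (W : vectType R) (x y : W) c d :
  c *: x + d *: y \in <<[:: x; y]>>%VS.
Proof.
by rewrite rpredD // rpredZ // memv_span // !inE eqxx ?orbT.
Qed.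

Lemma plane_a x : x \in <<[:: inc a; a']>>%VS -> x.1.1 = 0 /\ x.2.2 = 0.
Proof.
case/span_pair=> c [d ->]; rewrite incE /=.
by rewrite !scaler0 !addr0.
Qed.

Lemma plane_b x : x \in <<[:: inc (tub_b T); b']>>%VS ->
  exists c, [/\ x.1.1 = c *: null_root, x.1.2 = 0 & x.2.1 = 0].
Proof.
case/span_pair=> c [d ->]; exists c; rewrite incE tub_bE /=.
by rewrite !scaler0 !addr0.
Qed.

Lemma cover_decomposition : orthogonal_sum Bh (inc @: tub_Vfin T)
    <<[:: inc a; a']>> <<[:: inc (tub_b T); b']>>.
Proof.
split.
- apply/vspaceP => x; rewrite memvf.
  pose w := x.1.1 - x.1.1 0 i0 *: null_root.
  have w0 : w 0 i0 = 0 by rewrite !mxE n_i0 mulr1 subrr.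
  have -> : x = inc (w, 0) + ((x.1.2 : R) *: inc a + (x.2.1 : R) *: a') +
      (x.1.1 0 i0 *: inc (tub_b T) + (x.2.2 : R) *: b').
    have scale1 (c : R) : c *: (1 : R^o) = c by exact: mulr1.
    rewrite !incE tub_bE; apply: injective_projections;
      apply: injective_projections;
        rewrite /= ?scale1 ?scaler0 ?addr0 ?add0r //.
    by rewrite /w subrK.
  rewrite !memv_add ?mem_span_pair // memv_img //.
  rewrite [w]fin_decomp // (_ : (_,
    0) = \sum_(j < N) w 0 (sg (lift ord0 j)) *: alpha (lift ord0 j)).
    apply: memv_suml => j _; apply/memvZ/memv_span.
    exact: (codom_ord_mem (fun j => alpha (lift ord0 j))).
  apply: injective_projections => /=; first by rewrite sum_pair_fst.
  by rewrite sum_pair_snd big1 // => j _; rewrite /= scaler0.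
- have disjoint (F G : {vspace Vh}) : (forall x, x \in F -> x \in G -> x = 0) ->
      (F :&: G == 0)%VS.
    move=> FG; rewrite -subv0; apply/subvP => x /memv_capP[xF xG].
    by rewrite (FG x xF xG) mem0v.
  rewrite !directv_addE /= !directv_trivial /=; apply/andP; split;
    apply: disjoint.
    move=> x /Vfin_image[x1 x2 x3] /plane_a[x4 _].
    by apply: injective_projections => //; apply: injective_projections.
  move=> _ /memv_addP[u /Vfin_image[u1 u2 u3] [v /plane_a[v1 v2] ->]].
  move=> /[dup] x_b /plane_b[c [/= x1 x2 x3]].
  have c0 : c = 0.
    have := congr1 (fun w : Q => w 0 i0) x1.
    by rewrite v1 addr0 u1 !mxE n_i0 mulr1 => <-.
  apply: injective_projections; apply: injective_projections => //=.
    by rewrite x1 c0 scale0r.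
  by rewrite u3 v2 addr0.
- move=> u v /Vfin_image[u1 u2 u3] /plane_a[v1 v2].
  by rewrite BhE u1 u2 u3 v2 BE v1 std_formC // std_form0l /=; ring.
- move=> u v /Vfin_image[u1 u2 u3] /plane_b[c [v1 v2 v3]].
  rewrite BhE u1 u2 u3 v2 v3 BE v1 -[c *: _]addr0 std_formDr // q_null.
  by rewrite std_formC // std_form0l /=; ring.
- move=> u v /plane_a[u1 u2] /plane_b[c [v1 v2 v3]].
  by rewrite BhE u1 u2 v2 v3 BE u1 std_form0l mxE; ring.
Qed.

Lemma inc_injective : lker inc = 0%VS.
Proof. by apply/eqP/lker0P => u v; rewrite !incE => -[]. Qed.

Lemma inc_form u v : Bh (inc u) (inc v) = B u v.
Proof. by rewrite BhE !incE /=; ring. Qed.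

Definition affine_cover : hyperbolic_cover T :=
  @HyperbolicCover R T Vh Bh inc inc_injective inc_form a' b' pair_a pair_b
    cover_decomposition.

Lemma affine_cover_isomorphic :
  isomorphic (ext_system E) (cover_system affine_cover).
Proof.
have [] // := @cover_isomorphism R T affine_cover E sg' sg.
by move=> i j; rewrite /= BE /= !sg'K std_form_roots.
Qed.

End AffineCover.

Lemma extended_is_cover (R : realType) (E : ext_coxeter R) : affine_diagram E ->
  exists (T : tubular R) (H : hyperbolic_cover T),
    isomorphic (ext_system E) (cover_system H).
Proof.
move=> E_affine; have m_sym := @ext_m_sym R E.
have m_con : forall i j, connect (diagram (@ext_m R E)) i j.
  by have [[]] := ext_star E.
have [mk [mk_gt0 mk_harm]] := affine_marks m_sym m_con E_affine.
have d_sym : symmetric (diagram (@ext_m R E)) by move=> i j; exact: diagram_sym.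
have d_irr : irreflexive (diagram (@ext_m R E)) by move=> i;
  rewrite /diagram eqxx.
have [n [i0 [n_gt0 n_harm n_i0 n_max n_uniq]]] :=
  normal_marks d_sym d_irr (ext_star E) (@ext_t_max R E) mk_gt0 mk_harm.
have [N [sg [sg' [sgK sg'K sg0 kE]]]] := ordinal_from i0.
pose q := @std_form R _ (@ext_m R E).
have q_lin w c u v : q w (c *: u + v) = c * q w u + q w v by exact: std_formDr.
have q_sym u v : q u v = q v u by exact: std_formC.
pose V : vectType R := ('rV[R]_(ext_k E) * R^o)%type.
have [BQ BQE] := symmetric_exists q_lin q_sym.
have [||B BE] := @symmetric_exists R V (fun u v => q u.1 v.1).
- by move=> w c u v; exact: q_lin.
- by move=> u v; exact: q_sym.
have [|pi piE] := @hom_exists R V 'rV[R]_(ext_k E) (fun v => v.1).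
  by move=> c u v.
pose Vh : vectType R := (V * (R^o * R^o))%type.
have [||Bh BhE] := @symmetric_exists R Vh (fun u v => B u.1 v.1 +
  (u.2.1 * v.1.2 + v.2.1 * u.1.2 + (u.2.2 * v.1.1 0 i0 + v.2.2 * u.1.1 0 i0))).
- move=> w c u v /=; rewrite symP !mxE -![_ *: (_ : R^o)]/(_ * _); ring.
- by move=> u v; rewrite symC; ring.
have [|inc incE] := @hom_exists R V Vh (fun v => (v, 0)).
  by move=> c u v; apply: injective_projections; rewrite //= scaler0 addr0.
eexists; eexists; exact: (affine_cover_isomorphic E_affine n_gt0 n_harm n_i0
  n_max n_uniq sgK sg'K sg0 kE BE BQE piE BhE incE).
Qed.

Theorem theorem3p21 (R : realType) :
  (forall (T : tubular R) (H : hyperbolic_cover T),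
     exists E : ext_coxeter R, isomorphic (cover_system H) (ext_system E)) /\
  (forall E : ext_coxeter R, affine_diagram E ->
     exists (T : tubular R) (H : hyperbolic_cover T),
       isomorphic (ext_system E) (cover_system H)).
Proof. by split; [exact: cover_is_extended | exact: extended_is_cover]. Qed.
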